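(* Let $L$ be a finite flag simplicial complex, let $A_L$ be the right-angled Artin group defined by $L$, and let $F$ be any field. Then for every residual chain $(\Gamma_k)_k$ in $A_L$ and every integer $i\ge 0$, $$b_i^{(2)}(A_L;F)=\bar b_{i-1}(L;F),$$ where $b_i^{(2)}(A_L;F)$ is computed with respect to the chain $(\Gamma_k)_k$.
   Context: A flag complex is a simplicial complex in which every finite set of pairwise adjacent vertices spans a simplex. For a flag complex $L$ with vertex set $V$, the right-angled Artin group $A_L$ has generators $\{g_v\}_{v\in V}$ and relations $[g_v,g_{v'}]=1$ whenever $\{v,v'\}$ is an edge of $L$. A residual chain in a group $\Gamma$ is a nested decreasing sequence $(\Gamma_k)_k$ of finite index normal subgroups of $\Gamma$ with $\bigcap_k\Gamma_k=1$. For a group $\Gamma$ with a finite classifying space and a residual chain $(\Gamma_k)_k$ in $\Gamma$, define $$b_i^{(2)}(\Gamma;F):=\limsup_k\frac{b_i(B\Gamma_k;F)}{[\Gamma:\Gamma_k]},$$ where $B\Gamma_k$ is a classifying space of $\Gamma_k$ and $b_i(X;F)=\dim_F H_i(X;F)$. (The chain is suppressed from the notation.) $\bar b_j(L;F)=\dim_F\tilde H_j(L;F)$ denotes the reduced Betti number of $L$ with coefficients in $F$ (with the usual convention that $\tilde H_{-1}$ is nonzero, of dimension one, only for the empty complex). *)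

(* Defs.v *)
From HB Require Import structures.
From mathcomp Require Import all_boot all_order all_algebra.
From mathcomp Require Import finmap.
From mathcomp Require Import boolp classical_sets cardinality.
From mathcomp Require Import reals ereal topology sequences.
From mathcomp Require Import freeg.

Set Implicit Arguments.
Unset Strict Implicit.
Unset Printing Implicit Defensive.

Import Order.TTheory GRing.Theory Num.Theory.

Local Open Scope classical_set_scope.
Local Open Scope ring_scope.

(* A letter (x, false) stands for the generator x and (x, true) for its
   inverse; a relator is a word that is to become trivial. *)
Notation word X := (seq (X * bool)).

Inductive pres_eq (X : choiceType) (rels : set (word X)) :
    word X -> word X -> Prop :=
| pres_refl u : pres_eq rels u u
| pres_sym u v : pres_eq rels u v -> pres_eq rels v u
| pres_trans u v w : pres_eq rels u v -> pres_eq rels v w -> pres_eq rels u w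
| pres_cat u u' v v' : pres_eq rels u u' -> pres_eq rels v v' ->
    pres_eq rels (u ++ v) (u' ++ v')
| pres_cancel x b : pres_eq rels [:: (x, b); (x, ~~ b)] [::]
| pres_rel u : rels u -> pres_eq rels u [::].

Section PresentedGroup.
Variables (X : choiceType) (rels : set (word X)).

Definition pres_eqb : rel (word X) := [rel u v | `[< pres_eq rels u v >]].

Fact pres_eqb_equiv : equiv_class_of pres_eqb.
Proof.
split=> [u|u v|v u w] /=.
- exact/asboolP/pres_refl.
- by apply/asbool_equiv_eq; split; exact: pres_sym.
- by move=> /asboolP uv /asboolP vw; exact/asboolP/(pres_trans uv vw).
Qed.

Canonical pres_eqb_equivRel := EquivRelPack pres_eqb_equiv.

Definition presented := {eq_quot pres_eqb}%qT.
HB.instance Definition _ := Choice.on presented.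
HB.instance Definition _ := EqQuotient.on presented.

Definition word_inv (u : word X) : word X :=
  [seq (xb.1, ~~ xb.2) | xb <- rev u].

Definition pres_class (u : word X) : presented := (\pi_presented u)%qT.
Definition pres_one : presented := pres_class [::].
Definition pres_mul (a b : presented) : presented :=
  pres_class (repr a ++ repr b).
Definition pres_inv (a : presented) : presented :=
  pres_class (word_inv (repr a)).

Fact pres_classP u v : pres_class u = pres_class v <-> pres_eq rels u v.
Proof.
split=> [/eqmodP/asboolP //|uv].
by apply/eqmodP/asboolP.
Qed.

Fact pres_repr u : pres_eq rels (repr (pres_class u)) u.
Proof. by apply/pres_classP; rewrite /pres_class reprK. Qed.

Fact pres_mulE u v : pres_mul (pres_class u) (pres_class v) = pres_class (u ++ v).
Proof. by apply/pres_classP/pres_cat; exact: pres_repr. Qed.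

Fact pres_ind (P : presented -> Prop) :
  (forall u, P (pres_class u)) -> forall a, P a.
Proof. by move=> Pu a; rewrite -[a]reprK; exact: Pu. Qed.

Fact word_invV u : pres_eq rels (word_inv u ++ u) [::].
Proof.
elim: u => [|[x b] u IHu]; first exact: pres_refl.
rewrite /word_inv rev_cons map_rcons -cats1 -catA /=.
apply: pres_trans IHu; apply: pres_cat; first exact: pres_refl.
rewrite -[(x, b) :: u]cat1s -cat_cons -[u in X in pres_eq _ _ X]cat0s.
apply: pres_cat; last exact: pres_refl.
by rewrite -{2}[b]negbK; exact: pres_cancel.
Qed.

Fact word_invK : involutive word_inv.
Proof.
move=> u; rewrite /word_inv -map_rev revK -map_comp -[RHS]map_id.
by apply: eq_map => -[x b] /=; rewrite negbK.
Qed.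

Fact pres_mulA : associative pres_mul.
Proof.
elim/pres_ind=> u; elim/pres_ind=> v; elim/pres_ind=> w.
by rewrite !pres_mulE catA.
Qed.

Fact pres_mul1 : left_id pres_one pres_mul.
Proof. by elim/pres_ind=> u; rewrite pres_mulE. Qed.

Fact pres_mulr1 : right_id pres_one pres_mul.
Proof. by elim/pres_ind=> u; rewrite pres_mulE cats0. Qed.

Fact pres_mulV : left_inverse pres_one pres_inv pres_mul.
Proof.
move=> a; rewrite -{2}[a]reprK [LHS]pres_mulE.
exact/pres_classP/word_invV.
Qed.

Fact pres_mulrV : right_inverse pres_one pres_inv pres_mul.
Proof.
move=> a; rewrite -{1}[a]reprK [LHS]pres_mulE; apply/pres_classP.
by rewrite -{1}[repr a]word_invK; exact: word_invV.
Qed.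

HB.instance Definition _ := isGroup.Build presented
  pres_mulA pres_mul1 pres_mulr1 pres_mulV pres_mulrV.

End PresentedGroup.

(* Simplices are sets of vertices. The empty set counts as the (-1)-simplex,
   so that the empty complex has V empty and L = [set set0]. *)
Definition simplicial_complex (V : finType) (L : {set {set V}}) : Prop :=
  [/\ finset.set0 \in L, (forall v, [set v]%SET \in L)
    & forall s t : {set V}, s \in L -> t \subset s -> t \in L].

Definition adjacent (V : finType) (L : {set {set V}}) (v w : V) : bool :=
  (v != w) && ([set v; w]%SET \in L).

Definition flag (V : finType) (L : {set {set V}}) : Prop :=
  forall s : {set V}, {in s &, forall v w, v != w -> adjacent L v w} -> s \in L.

(* The relators are the words v^-1 w^-1 v w. *)
Definition raag_relators (V : finType) (L : {set {set V}}) : set (word V) :=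
  [set u | exists v w, adjacent L v w /\
     u = [:: (v, true); (w, true); (v, false); (w, false)]].

Definition raag (V : finType) (L : {set {set V}}) : groupType :=
  presented (raag_relators L).

Definition subgroup (G : groupType) (N : groupClosed G) := {x : G | x \in N}.

HB.instance Definition _ (G : groupType) (N : groupClosed G) :=
  SubChoice.on (subgroup N).

Fact subgroup_closed (G : groupType) (N : groupClosed G) :
  group_closed (mem N).
Proof. by split; [exact: gpred1 | exact: gpredF]. Qed.

HB.instance Definition _ (G : groupType) (N : groupClosed G) :=
  SubChoice_isSubGroup.Build G (mem N) (subgroup N) (subgroup_closed N).

Definition normal_subgroup (G : groupType) (N : groupClosed G) : Prop :=
  forall x y : G, x \in N -> (x ^ y)%g \in N.

Definition left_cosets (G : groupType) (N : groupClosed G) : set (set G) :=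
  range (fun x : G => [set y : G | (x^-1 * y)%g \in N]).

(* Equal to 0 when the index is infinite. *)
Definition group_index (G : groupType) (N : groupClosed G) : nat :=
  #|` fset_set (left_cosets N)|%fset.

Definition residual_chain (G : groupType) (Gam : nat -> groupClosed G) : Prop :=
  [/\ forall k, {subset Gam k.+1 <= Gam k},
      forall k, normal_subgroup (Gam k),
      forall k, finite_set (left_cosets (Gam k))
    & forall x : G, (forall k, x \in Gam k) -> x = 1%g].

Section Betti.
Variables (R : realType) (F : fieldType).

Definition basis_mod (M : lmodType F) (Z B : set M) n (z : 'I_n -> M) : Prop :=
  [/\ forall j, Z (z j),
      forall c, Z c -> exists a : 'I_n -> F, B (c - \sum_j a j *: z j)
    & forall a : 'I_n -> F, B (\sum_j a j *: z j) -> forall j, a j = 0].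

(* The dimension of Z / B, for subspaces B of Z: the cardinality of a basis,
   and +oo (the infimum of the empty set) if there is no finite basis. *)
Definition dim_mod (M : lmodType F) (Z B : set M) : \bar R :=
  ereal_inf [set n%:R%:E | n in [set n | exists z : 'I_n -> M, basis_mod Z B z]].

(* Homology of the chain complex whose degree i part is the free module on the
   cells x with P x and deg x = i, with differential the linear extension of
   bd. *)
Section Complex.
Variables (X : choiceType) (P : pred X) (deg : X -> int).
Variable bd : X -> {freeg X / F}.

Definition chains (i : int) : set {freeg X / F} :=
  [set c | forall x, coeff x c != 0 -> P x /\ deg x = i].

Definition cycles (i : int) := chains i `&` [set c | fglift bd c = 0].

Definition boundaries (i : int) := fglift bd @` chains (i + 1).

Definition betti (i : int) : \bar R := dim_mod (cycles i) (boundaries i).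
End Complex.

(* The classifying space BG is modelled by the nerve of G, whose n-simplices
   are the words [g_1 | ... | g_n] in G, with the usual faces
     d_0 = [g_2 | ... | g_n],
     d_k = [g_1 | ... | g_k g_{k+1} | ... | g_n]  for 0 < k < n,
     d_n = [g_1 | ... | g_{n-1}]. *)
Definition nerve_face (G : groupType) (k : nat) (s : seq G) : seq G :=
  if k == 0%N then behead s
  else if k == size s then take k.-1 s
  else take k.-1 s ++ (nth 1 s k.-1 * nth 1 s k)%g :: drop k.+1 s.

Definition nerve_bd (G : groupType) (s : seq G) : {freeg (seq G) / F} :=
  if nilp s then 0
  else \sum_(k < (size s).+1) (-1) ^+ k *: << nerve_face k s >>.

Definition group_betti (G : groupType) : int -> \bar R :=
  betti xpredT (fun s : seq G => (size s)%:Z) (@nerve_bd G).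

(* Simplices are oriented by the enumeration order of V; the empty simplex in
   degree -1 provides the augmentation. *)
Definition simplex_bd (V : finType) (s : {set V}) : {freeg {set V} / F} :=
  \sum_(v in s)
    (-1) ^+ #|[set w in s | (enum_rank w < enum_rank v)%N]%SET| *: << (s :\ v)%SET >>.

Definition reduced_betti (V : finType) (L : {set {set V}}) : int -> \bar R :=
  betti (mem L) (fun s : {set V} => #|s|%:Z - 1) (@simplex_bd V).

Definition l2_betti (G : groupType) (Gam : nat -> groupClosed G) (i : int) :
    \bar R :=
  limn_esup (fun k =>
    (group_betti (subgroup (Gam k)) i * ((group_index (Gam k))%:R^-1)%:E)%E).

End Betti.

(* Main.v *)
(* Let G be the group A_L, let N be a member of the chain and Q = G / N.

   The Salvetti complex has the free F[G]-module on the simplices s of L (with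
   the empty simplex) in degree #|s|, and the differential which sends s to the
   sum of the terms +-(g_v - 1) (s \ v). It is exact: order the cubes by the word
   length of their longest vertex; the descents at a vertex commute pairwise, so
   they span a simplex of L because L is flag, and the cubes with a given longest
   vertex x <> 1 form the augmented complex of this nonempty simplex. Lengths and
   descents are read off from pilings. Comparing this resolution with the bar
   resolution of N, the homology of N is that of the complex F[Q] (x) F[L] with
   the differential above.

   Replacing the coefficients g_v - 1 by 1, one vertex v at a time, leads to
   |Q| copies of the augmented simplicial chain complex of L. At each step, the
   multiplication by g_v - 1 on the simplices which contain v is a chain map, and
   its corank is at most the number of cells divided by the order of g_v in Q.
   This order tends to infinity along the chain, so the ranks of all differentials
   change by o(|Q|) only. *)
From HB Require Import structures.
From mathcomp Require Import all_boot all_order all_algebra.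
From mathcomp Require Import finmap zify.
From mathcomp Require Import boolp classical_sets cardinality.
From mathcomp Require Import reals ereal topology normedtype sequences.
From mathcomp Require Import freeg.
Require Import Defs.

Set Implicit Arguments.
Unset Strict Implicit.
Unset Printing Implicit Defensive.

Import Order.TTheory GRing.Theory Num.Theory.
Import numFieldNormedType.Exports.

Local Open Scope ring_scope.

(** Since F may have positive characteristic, von Neumann dimensions are of no help and the ranks
    are compared by hand in each finite quotient. If A P = P B for square matrices, the ranks of A
    and B differ by at most the corank of P, so a nearly invertible map does the work of a chain
    equivalence. For P = g_v - 1 on F[Q] the kernel consists of the vectors constant along the
    orbits of g_v, which all have the order of g_v as their length; this bounds the corank. The
    order grows because g_v has infinite order in A_L, so that its powers below a given exponent m
    eventually leave the nested chain for good. The price is |V| replacements per differential, each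
    at |Q| 2^|V| / m; hence the normalized Betti numbers converge, and the upper limit is a limit.
    The shift from i to i - 1 arises because a simplex with n vertices labels cubes of dimension n:
    the empty simplex labels the vertices of the cubes, and in L it is the augmentation. *)

(** * Pilings, an invariant of words in a right-angled Artin group *)

Section Pilings.
Variables (V : finType) (L : {set {set V}}).

Local Notation adj := (adjacent L).
Local Notation letter := (V * bool)%type.

Lemma adjacentC v w : adj v w = adj w v.
Proof. by rewrite /adjacent eq_sym finset.setUC. Qed.

Lemma adjacent_neq v w : adj v w -> v != w.
Proof. by case/andP. Qed.

(* A piling (Crisp, Godelle and Wiest) has one stack for each vertex, with the
   beads [Some b] of the letters (v, b) and the blanks [None] that these put on
   the stacks of the vertices which do not commute with v. *)
Definition piling := V -> seq (option bool).

Definition top (p : piling) (v : V) : option bool := head None (p v).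

Definition push (p : piling) (s : letter) : piling := fun w =>
  if w == s.1 then Some s.2 :: p w else if adj s.1 w then p w else None :: p w.

(** The inverse of [push]: as [adj v v] is false, the bead on the stack of v goes too. The entries
    removed from the other stacks are blanks when [p] is a push by v. *)
Definition pop (p : piling) (v : V) : piling := fun w =>
  if adj v w then p w else behead (p w).

Definition step (p : piling) (s : letter) : piling :=
  if top p s.1 == Some (~~ s.2) then pop p s.1 else push p s.

Definition pile (u : word V) : piling := foldl step (fun=> [::]) u.

Lemma pile_rcons u s : pile (rcons u s) = step (pile u) s.
Proof. by rewrite /pile foldl_rcons. Qed.

Lemma top_push p s : top (push p s) s.1 = Some s.2.
Proof. by rewrite /top /push eqxx. Qed.

Lemma top_push_adj p s w : adj s.1 w -> top (push p s) w = top p w.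
Proof.
by move=> a; rewrite /top /push eq_sym (negPf (adjacent_neq a)) a.
Qed.

Lemma top_push_nadj p s w : w != s.1 -> ~~ adj s.1 w -> top (push p s) w = None.
Proof. by move=> n a; rewrite /top /push (negPf n) (negPf a). Qed.

Lemma top_step_adj p s w : adj s.1 w -> top (step p s) w = top p w.
Proof.
move=> a; rewrite /step; case: ifP => _; last exact: top_push_adj.
by rewrite /top /pop a.
Qed.

Lemma push_pop p s : pop (push p s) s.1 = p.
Proof.
apply/funext => w; rewrite /pop /push.
case: (eqVneq w s.1) => [->|n]; last by case: (adj s.1 w).
by rewrite /adjacent eqxx.
Qed.

Lemma step_push p v b : step (push p (v, ~~ b)) (v, b) = p.
Proof. by rewrite /step (top_push _ (v, _)) eqxx (push_pop _ (v, _)). Qed.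

Lemma push_comm p s t : adj s.1 t.1 -> push (push p s) t = push (push p t) s.
Proof.
move=> a; apply/funext => w; rewrite /push.
have n := adjacent_neq a.
case: (eqVneq w s.1) => [->|ns].
  by rewrite (negPf n) adjacentC a.
case: (eqVneq w t.1) => [->|nt]; first by rewrite a.
by case: (adj s.1 w); case: (adj t.1 w).
Qed.

(** The recursion takes the last letter first. Reduced means that the pile only grows: no letter
    meets its inverse on top of its stack. *)
Fixpoint reduced_rev (u : word V) : bool :=
  if u is s :: u' then (top (pile (rev u')) s.1 != Some (~~ s.2)) && reduced_rev u'
  else true.

Definition reduced_word (u : word V) := reduced_rev (rev u).

Lemma reduced_rcons u s :
  reduced_word (rcons u s) = (top (pile u) s.1 != Some (~~ s.2)) && reduced_word u.
Proof. by rewrite /reduced_word rev_rcons /= revK. Qed.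

Lemma pile_reduced_rcons u s :
  reduced_word (rcons u s) -> pile (rcons u s) = push (pile u) s.
Proof. by rewrite reduced_rcons pile_rcons /step => /andP[/negPf->]. Qed.

Local Notation "u ~ v" := (pres_eq (raag_relators L) u v) (at level 70).

Lemma raag_cancel_rcons u v b : rcons (rcons u (v, b)) (v, ~~ b) ~ u.
Proof.
rewrite -!cats1 -catA -[X in _ ~ X]cats0; apply: pres_cat; first exact: pres_refl.
exact: pres_cancel.
Qed.

Lemma pres_catl (w u v : word V) : u ~ v -> w ++ u ~ w ++ v.
Proof. by apply: pres_cat; exact: pres_refl. Qed.

Lemma pres_catr (w u v : word V) : u ~ v -> u ++ w ~ v ++ w.
Proof. by move=> uv; apply: pres_cat uv _; exact: pres_refl. Qed.

(** The relators give only w^-1 v w = v. Conjugation exchanges w and w^-1 here, and the remaining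
    signs follow by inserting cancelling pairs. *)
Lemma letters_comm (s t : letter) : adj s.1 t.1 -> [:: s; t] ~ [:: t; s].
Proof.
have rel v w : adj v w -> [:: (w, true); (v, false); (w, false)] ~ [:: (v, false)].
  move=> a; pose r := [:: (v, true); (w, true); (v, false); (w, false)].
  apply: (@pres_trans _ _ _ ((v, false) :: r)).
    apply: (@pres_catr [:: (w, true); (v, false); (w, false)] [::]
              [:: (v, false); (v, true)]).
    exact/pres_sym/pres_cancel.
  apply: (@pres_catl [:: (v, false)] r [::]); apply: pres_rel.
  by exists v, w.
have inv v w b : adj v w -> [:: (w, ~~ b); (v, false); (w, b)] ~ [:: (v, false)].
  move=> a; case: b; last exact: rel.
  apply: pres_trans (_ : [:: (w, false)] ++ [:: (w, true); (v, false); (w, false)]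
                         ++ [:: (w, true)] ~ _).
    apply: (@pres_catl [:: (w, false)] [:: (v, false); (w, true)]
              [:: (w, true); (v, false); (w, false); (w, true)]).
    apply: (@pres_catr [:: (w, true)] [:: (v, false)]
              [:: (w, true); (v, false); (w, false)]).
    exact/pres_sym/rel.
  apply: pres_trans (_ : [:: (v, false); (w, false); (w, true)] ~ _).
    apply: (@pres_catr [:: (v, false); (w, false); (w, true)]
              [:: (w, false); (w, true)] [::]).
    exact: pres_cancel.
  by apply: (@pres_catl [:: (v, false)] [:: (w, false); (w, true)] [::]); exact: pres_cancel.
have comm v w b : adj v w -> [:: (v, false); (w, b)] ~ [:: (w, b); (v, false)].
  move=> a; apply: pres_trans (_ : [:: (w, b); (w, ~~ b); (v, false); (w, b)] ~ _).
    apply: (@pres_catr [:: (v, false); (w, b)] [::] [:: (w, b); (w, ~~ b)]).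
    exact/pres_sym/pres_cancel.
  apply: (@pres_catl [:: (w, b)] [:: (w, ~~ b); (v, false); (w, b)] [:: (v, false)]).
  exact: inv.
case: s t => [v c] [w b] /= a; case: c; last exact: comm.
apply: pres_trans (_ : [:: (v, true); (w, b); (v, false); (v, true)] ~ _).
  apply: (@pres_catl [:: (v, true); (w, b)] [::] [:: (v, false); (v, true)]).
  exact/pres_sym/pres_cancel.
apply: pres_trans (_ : [:: (v, true); (v, false); (w, b); (v, true)] ~ _).
  apply: (@pres_catl [:: (v, true)] [:: (w, b); (v, false); (v, true)]
            [:: (v, false); (w, b); (v, true)]).
  apply: (@pres_catr [:: (v, true)] [:: (w, b); (v, false)] [:: (v, false); (w, b)]).
  exact/pres_sym/comm.
apply: (@pres_catr [:: (w, b); (v, true)] [:: (v, true); (v, false)] [::]).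
exact: pres_cancel.
Qed.

(** The letters that follow the one of a visible bead have put no blank on it. They commute with it,
    so it can be moved to the end of the word. *)
Lemma reduced_top u s : reduced_word u -> top (pile u) s.1 = Some s.2 ->
  exists2 u', reduced_word (rcons u' s) & u ~ rcons u' s /\ pile u = pile (rcons u' s).
Proof.
elim/last_ind: u => [|u t IHu] //= red_ut; rewrite (pile_reduced_rcons red_ut).
have [t1s|nts] := eqVneq s.1 t.1.
  rewrite t1s top_push => -[t2s]; have <- : t = s.
    by case: s t t1s t2s {IHu red_ut} => [? ?] [? ?] /= -> ->.
  exists u => //; split; first exact: pres_refl.
  by rewrite pile_reduced_rcons.
have [ats|nats] := boolP (adj t.1 s.1); last by rewrite top_push_nadj.
rewrite top_push_adj // => tops.
move: red_ut; rewrite reduced_rcons => /andP[topt redu].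
have [u' red' [eqw eqp]] := IHu redu tops.
have ast : adj s.1 t.1 by rewrite adjacentC.
have red1 : reduced_word (rcons u' t).
  move: (red'); rewrite !reduced_rcons => /andP[_ ->]; rewrite andbT.
  by move: topt; rewrite eqp pile_reduced_rcons // top_push_adj.
have red2 : reduced_word (rcons (rcons u' t) s).
  rewrite reduced_rcons red1 andbT pile_reduced_rcons // top_push_adj //.
  by move: red'; rewrite reduced_rcons => /andP[].
exists (rcons u' t) => //; split.
  apply: pres_trans (_ : rcons (rcons u' s) t ~ _).
    by rewrite -!cats1; apply: pres_catr; rewrite cats1.
  by rewrite -!cats1 -!catA; apply: pres_catl; exact: letters_comm.
by rewrite eqp !pile_reduced_rcons //; exact: push_comm.
Qed.

Lemma reduce_word u : exists2 u', reduced_word u' & u ~ u' /\ pile u = pile u'.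
Proof.
elim/last_ind: u => [|u s [u' red' [eqw eqp]]].
  by exists [::] => //; split=> //; exact: pres_refl.
have eqws : rcons u s ~ rcons u' s by rewrite -!cats1; exact: pres_catr.
have [tops|tops] := eqVneq (top (pile u') s.1) (Some (~~ s.2)); last first.
  exists (rcons u' s); first by rewrite reduced_rcons tops.
  by split=> //; rewrite !pile_rcons eqp.
have [u'' red'' [eqw' eqp']] := @reduced_top u' (s.1, ~~ s.2) red' tops.
exists u''; first by move: red''; rewrite reduced_rcons => /andP[].
split; last first.
  by rewrite pile_rcons /step eqp tops eqxx eqp' pile_reduced_rcons // (push_pop _ (_, _)).
apply: pres_trans eqws _; apply: pres_trans (_ : rcons (rcons u'' (s.1, ~~ s.2)) s ~ _).
  by rewrite -!cats1; apply: pres_catr; rewrite cats1.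
by have := raag_cancel_rcons u'' s.1 (~~ s.2); rewrite negbK -surjective_pairing.
Qed.

(** Arbitrary stacks with a bead on top need not be a push, as blanks may be missing elsewhere; in
    the pile of a word the bead is the last letter of some reduced word. The second clause ensures
    that adding s to [u'] is a push and not a cancellation. *)
Lemma top_pileP u s : top (pile u) s.1 = Some s.2 ->
  exists u', [/\ pile u = push (pile u') s, top (pile u') s.1 != Some (~~ s.2)
    & u ~ rcons u' s].
Proof.
have [u1 red1 [eqw1 ->]] := reduce_word u => tops.
have [u2 red2 [eqw2 ->]] := reduced_top red1 tops.
exists u2; split; first exact: pile_reduced_rcons.
  by move: red2; rewrite reduced_rcons => /andP[].
exact: pres_trans eqw2.
Qed.

Lemma step_cancel u v b : step (step (pile u) (v, b)) (v, ~~ b) = pile u.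
Proof.
rewrite {2}/step /=; case: eqVneq => [tops|tops].
  have [u' [-> n _]] := @top_pileP u (v, ~~ b) tops.
  by rewrite (push_pop _ (_, _)) /step (negPf n).
by rewrite /step (top_push _ (v, b)) /= negbK eqxx (push_pop _ (_, _)).
Qed.

(** [half] covers the case in which s is pushed, whatever t does. By symmetry there remain two pops,
    where [top_pileP] exposes both beads. *)
Lemma step_comm u s t : adj s.1 t.1 ->
  step (step (pile u) s) t = step (step (pile u) t) s.
Proof.
move: s t => [v b] [w c] /= a.
have a' : adj w v by rewrite adjacentC.
have half s t u1 : adj s.1 t.1 -> top (pile u1) s.1 <> Some (~~ s.2) ->
    step (push (pile u1) s) t = step (step (pile u1) t) s.
  move=> ast ns; rewrite [RHS]/step top_step_adj 1?adjacentC //.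
  move/eqP/negPf: ns => ->; rewrite /step top_push_adj //.
  case: eqVneq => tt; last exact: push_comm.
  have [u2 [-> _ _]] := @top_pileP u1 (t.1, ~~ t.2) tt.
  by rewrite push_comm 1?adjacentC // !(push_pop _ (t.1, _)).
have [tv|/eqP tv] := eqVneq (top (pile u) v) (Some (~~ b)); last first.
  rewrite -(half (v, b) (w, c)) //; congr (step _ _).
  by rewrite /step (negPf (introN eqP tv)).
have [tw|/eqP tw] := eqVneq (top (pile u) w) (Some (~~ c)); last first.
  rewrite -(half (w, c) (v, b)) //; congr (step _ _).
  by rewrite /step (negPf (introN eqP tw)).
have [u1 [e1 n1 _]] := @top_pileP u (v, ~~ b) tv.
move: tw; rewrite e1 top_push_adj // => tw1.
have [u2 [e2 n2 _]] := @top_pileP u1 (w, ~~ c) tw1.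
by rewrite e2 !step_push [in RHS]push_comm // !step_push.
Qed.

Lemma pile_pres_eq u v : u ~ v -> pile u = pile v.
Proof.
have cat u1 u2 : pile (u1 ++ u2) = foldl step (pile u1) u2.
  by rewrite /pile foldl_cat.
(* The induction needs an arbitrary prefix: cancellation and commutation of steps are available only
   on piles of words, and a subword acts on the pile of what precedes it. *)
suff inv : u ~ v -> forall w, pile (w ++ u) = pile (w ++ v).
  by move=> uv; exact: (inv uv [::]).
elim=> {u v} [|u v _ IH|u v w _ IHu _ IHv|u u' v v' _ IHu _ IHv|v b|r] //.
- by move=> z; rewrite IHu.
- by move=> z; rewrite !catA cat IHu -cat IHv.
- by move=> z; rewrite cat cats0 /= step_cancel.
move=> [v [w [a ->]]] z; rewrite cats0 cat /=.
rewrite -(pile_rcons z (v, true)).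
rewrite (@step_comm (rcons z (v, true)) (w, true) (v, false)); last by rewrite adjacentC.
by rewrite pile_rcons (step_cancel _ v true) (step_cancel _ w true).
Qed.

End Pilings.

(** * Word length and descents *)

Section RaagLength.
Variables (V : finType) (L : {set {set V}}).

Local Notation adj := (adjacent L).
Local Notation G := (raag L).
Local Notation class := (pres_class (raag_relators L)).

Definition gen (v : V) : G := class [:: (v, false)].

Definition gpile (x : G) : piling V := pile L (repr (x : presented (raag_relators L))).

Definition bead (x : G) (v : V) : option bool := top (gpile x) v.

(** A reduced word leaves one bead per letter, so this is the word length; blanks do not count. *)
Definition len (x : G) : nat := (\sum_v count isSome (gpile x v))%N.

Lemma gpile_class u : gpile (class u) = pile L u.
Proof. exact/pile_pres_eq/pres_repr. Qed.

Lemma gpile_mul x s : gpile (x * class [:: s])%g = step L (gpile x) s.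
Proof.
elim/pres_ind: x => u; rewrite [(_ * _)%g]pres_mulE !gpile_class.
by rewrite cats1 pile_rcons.
Qed.

Lemma gen_inv v : ((gen v)^-1)%g = class [:: (v, true)].
Proof.
apply: (mulgI (gen v)); rewrite mulgV [RHS]pres_mulE; apply/esym/pres_classP.
exact: pres_cancel.
Qed.

Lemma gen_comm v w : adj v w -> (gen v * gen w = gen w * gen v)%g.
Proof.
move=> a; rewrite [LHS]pres_mulE [RHS]pres_mulE; apply/pres_classP.
exact: letters_comm.
Qed.

Lemma gpile_gen x v : gpile (x * gen v)%g = step L (gpile x) (v, false).
Proof. exact: gpile_mul. Qed.

Lemma gpile_genV x v : gpile (x * (gen v)^-1)%g = step L (gpile x) (v, true).
Proof. by rewrite gen_inv gpile_mul. Qed.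

Lemma bead_adj x v w : adj v w -> bead (x * gen v)%g w = bead x w.
Proof. by move=> a; rewrite /bead gpile_gen top_step_adj. Qed.

Lemma count_push p (s : V * bool) :
  (\sum_v count isSome (push L p s v) = (\sum_v count isSome (p v)).+1)%N.
Proof.
rewrite (bigD1 s.1) //= [in RHS](bigD1 s.1) //= {1}/push eqxx /= add1n addSn.
congr (_ + _).+1; apply: eq_bigr => w ns; rewrite /push (negPf ns).
by case: (adj _ _).
Qed.

Lemma bead_top x s : bead x s.1 = Some s.2 ->
  exists2 p, gpile x = push L p s & top p s.1 != Some (~~ s.2).
Proof. by case/top_pileP => u [e n _]; exists (pile L u). Qed.

Lemma gen_up x v : bead x v != Some true ->
  bead (x * gen v)%g v = Some false /\ len (x * gen v)%g = (len x).+1.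
Proof.
rewrite /bead /len gpile_gen => nt; rewrite /step (negPf nt).
by rewrite (top_push _ _ (v, false)) count_push.
Qed.

Lemma gen_down x v : bead x v = Some true -> len x = (len (x * gen v)%g).+1.
Proof.
case/(@bead_top x (v, true)) => p e _.
by rewrite /len gpile_gen e (step_push _ p v false) count_push.
Qed.

Lemma genV_down x v : bead x v = Some false ->
  bead (x * (gen v)^-1)%g v != Some true.
Proof.
case/(@bead_top x (v, false)) => p e.
by rewrite /bead gpile_genV e (step_push _ p v true).
Qed.

(** The last letter v covers every stack that does not commute with it by a blank, so a second
    visible bead belongs to a neighbour of v. *)
Lemma bead_comm x v w : bead x v != None -> bead x w != None -> v != w -> adj v w.
Proof.
rewrite /bead; case tv: (top _ v) => [b|] // _ tw; rewrite eq_sym => nvw.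
have [p e _] := @bead_top x (v, b) tv.
by apply: contraNT tw => na; rewrite e top_push_nadj.
Qed.

Lemma bead_neq1 x : x != 1%g -> exists v, bead x v != None.
Proof.
rewrite /bead /gpile => nx1.
have [u + [xu ->]] := reduce_word L (repr (x : presented (raag_relators L))).
case/lastP: u xu => [x1|u s _ red].
  case/eqP: nx1; rewrite -[x]reprK; exact/pres_classP.
by exists s.1; rewrite pile_reduced_rcons // top_push.
Qed.

Lemma gpile1 v : gpile 1%g v = [::].
Proof. by rewrite gpile_class. Qed.

Lemma bead1 v : bead 1%g v = None.
Proof. by rewrite /bead /top gpile1. Qed.

Lemma len1 : len 1%g = 0%N.
Proof. by apply: big1 => v _; rewrite gpile1. Qed.

Lemma len_eq0 x : len x = 0%N -> x = 1%g.
Proof.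
move=> l0; apply/eqP/negPn/negP => /bead_neq1[v]; case bv: (bead x v) => [b|] // _.
have [p e _] := @bead_top x (v, b) bv.
by move: l0; rewrite /len e count_push.
Qed.

(** The positive bead stays on top, so each further factor lengthens the power by one. *)
Lemma gen_order v n : (0 < n)%N -> (gen v ^+ n)%g != 1%g.
Proof.
suff: len (gen v ^+ n)%g = n /\ bead (gen v ^+ n)%g v != Some true.
  by case=> l _; apply: contraTneq => e; rewrite -l e len1.
elim: n => [|n [IHl IHb]]; first by rewrite expg0 len1 bead1.
by rewrite expgSr; have [-> ->] := gen_up IHb; rewrite IHl.
Qed.

End RaagLength.

(** * Linear extensions, supports of chains, dimensions of quotients *)

Section FreeModules.
Variable F : fieldType.
Implicit Types (X Y : choiceType) (M N : lmodType F).

Lemma fgliftE X M (f : X -> M) (c : {freeg X / F}) :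
  fglift f c = \sum_(x <- dom c) coeff x c *: f x.
Proof.
rewrite -{1}[c]freeg_sumE.
have fD := lift_is_additive f.
have f0 : fglift f 0 = 0 by rewrite -{1}[0]subr0 fD subrr.
have fN b : fglift f (- b) = - fglift f b by rewrite -sub0r fD f0 sub0r.
elim/big_rec2: _ => // x m b _ <-.
by rewrite -[b in LHS]opprK fD fN opprK liftU.
Qed.

Fact fglift_is_linear X M (f : X -> M) : linear (fglift f).
Proof.
have fD := lift_is_additive f.
have f0 : fglift f 0 = 0 by rewrite -{1}[0]subr0 fD subrr.
have fN b : fglift f (- b) = - fglift f b by rewrite -sub0r fD f0 sub0r.
move=> k b c; rewrite -[c in LHS]opprK fD fN opprK; congr (_ + _).
have [->|k0] := eqVneq k 0; first by rewrite !scale0r.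
rewrite !fgliftE (perm_big (dom b)).
  by rewrite scaler_sumr; apply: eq_bigr => x _; rewrite coeffZ scalerA.
by apply: uniq_perm; rewrite ?uniq_dom // => x; rewrite domZ.
Qed.

HB.instance Definition _ X M (f : X -> M) :=
  GRing.isLinear.Build F {freeg X / F} M *:%R (fglift f) (fglift_is_linear f).

Lemma fglift1 X M (f : X -> M) x : fglift f << x >> = f x.
Proof. by rewrite liftU scale1r. Qed.

Lemma fgliftU X (c : {freeg X / F}) : fglift (fun x => << x >>) c = c.
Proof.
rewrite fgliftE -[RHS]freeg_sumE; apply: eq_bigr => x _.
by apply/eqP/freeg_eqP => y; rewrite coeffZ !coeffU mul1r.
Qed.

Lemma linear_fglift X M N (g : {linear M -> N}) (f : X -> M) (c : {freeg X / F}) :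
  g (fglift f c) = fglift (fun x => g (f x)) c.
Proof. by rewrite !fgliftE linear_sum; apply: eq_bigr => x _; rewrite linearZ. Qed.

Lemma fglift_sub X M (f g : X -> M) (c : {freeg X / F}) :
  fglift (fun x => f x - g x) c = fglift f c - fglift g c.
Proof. by rewrite !fgliftE -sumrB; apply: eq_bigr => x _; rewrite scalerBr. Qed.

Definition on X (A : X -> Prop) (c : {freeg X / F}) : Prop :=
  forall x, coeff x c != 0 -> A x.

Lemma on_closed X (A : X -> Prop) (a : F) b c : on A b -> on A c -> on A (a *: b + c).
Proof.
move=> Ab Ac x; rewrite coeffD coeffZ.
have [->|nz] := eqVneq (coeff x b) 0; last by move=> _; exact: Ab.
by rewrite mulr0 add0r; exact: Ac.
Qed.

Lemma on0 X (A : X -> Prop) : on A 0.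
Proof. by move=> x; rewrite coeff0 eqxx. Qed.

Lemma onD X (A : X -> Prop) b c : on A b -> on A c -> on A (b + c).
Proof. by rewrite -[b in on A (b + c)]scale1r; exact: on_closed. Qed.

Lemma onZ X (A : X -> Prop) a b : on A b -> on A (a *: b).
Proof. by move=> Ab; rewrite -[_ *: _]addr0; apply: on_closed => //; exact: on0. Qed.

Lemma onB X (A : X -> Prop) b c : on A b -> on A c -> on A (b - c).
Proof. by move=> Ab Ac; rewrite -scaleN1r; apply: onD => //; exact: onZ. Qed.

Lemma onU X (A : X -> Prop) x : A x -> on A << x >>.
Proof.
by move=> Ax y; rewrite coeffU mul1r; case: (x =P y) => [<- //|_]; rewrite mulr0n eqxx.
Qed.

Lemma on_sum X (A : X -> Prop) (I : Type) (r : seq I) (P : pred I) (f : I -> {freeg X / F}) :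
  (forall i, P i -> on A (f i)) -> on A (\sum_(i <- r | P i) f i).
Proof. by move=> Af; elim/big_ind: _ => //; [exact: on0|exact: onD]. Qed.

Lemma on_fglift X Y (A : X -> Prop) (B : Y -> Prop) (f : X -> {freeg Y / F}) c :
  on A c -> (forall x, A x -> on B (f x)) -> on B (fglift f c).
Proof.
move=> Ac fB; rewrite fgliftE big_seq; apply: on_sum => x xc.
by apply: onZ; apply: fB; apply: Ac; rewrite -mem_dom.
Qed.

Lemma on_imp X (A B : X -> Prop) c : on A c -> (forall x, A x -> B x) -> on B c.
Proof. by move=> Ac AB x /Ac /AB. Qed.

Lemma on_empty X (A : X -> Prop) c : on A c -> (forall x, ~ A x) -> c = 0.
Proof.
move=> Ac A0; apply/eqP/freeg_eqP => x; rewrite coeff0.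
by apply/eqP/negPn/negP => /Ac /A0.
Qed.

Lemma eq_fglift_on X M (A : X -> Prop) (f g : X -> M) c :
  on A c -> (forall x, A x -> f x = g x) -> fglift f c = fglift g c.
Proof.
move=> Ac fg; rewrite !fgliftE; apply: eq_big_seq => x xc.
by rewrite fg //; apply: Ac; rewrite -mem_dom.
Qed.

Lemma eq_fglift X M (f g : X -> M) : f =1 g -> fglift f =1 fglift g.
Proof. by move=> fg c; rewrite !fgliftE; apply: eq_bigr => x _; rewrite fg. Qed.

Lemma fglift_eq0_on X M (A : X -> Prop) (f : X -> M) c :
  on A c -> (forall x, A x -> f x = 0) -> fglift f c = 0.
Proof.
move=> Ac f0; rewrite fgliftE big_seq big1 // => x xc.
by rewrite f0 ?scaler0 //; apply: Ac; rewrite -mem_dom.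
Qed.

Definition subspace M (B : set M) : Prop :=
  B 0 /\ forall a b c, B b -> B c -> B (a *: b + c).

Lemma subspace_sum M (B : set M) n (a : 'I_n -> F) (z : 'I_n -> M) :
  subspace B -> (forall j, B (z j)) -> B (\sum_j a j *: z j).
Proof.
move=> [B0 Bl] Bz; elim/big_ind: _ => // [b c Bb Bc|j _].
  by rewrite -[b]scale1r; exact: Bl.
by rewrite -[_ *: _]addr0; exact: Bl.
Qed.

Lemma subspaceB M (B : set M) b c : subspace B -> B b -> B c -> B (b - c).
Proof. by move=> [_ Bl] Bb Bc; rewrite addrC -scaleN1r; exact: Bl. Qed.

Lemma subspace_chains X (P : pred X) (deg : X -> int) i :
  subspace (chains (F := F) P deg i).
Proof. by split; [exact: on0|move=> a b c; exact: on_closed]. Qed.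

Lemma subspace_cycles X (P : pred X) (deg : X -> int) bd i :
  subspace (cycles (F := F) P deg bd i).
Proof.
have [s0 sl] := subspace_chains P deg i.
split; first by split=> //=; rewrite linear0.
by move=> a b c [? b0] [? c0]; split=> /=; [exact: sl|rewrite linearP /= b0 c0 scaler0 addr0].
Qed.

Lemma subspace_boundaries X (P : pred X) (deg : X -> int) bd i :
  subspace (boundaries (F := F) P deg bd i).
Proof.
have [s0 sl] := subspace_chains P deg (i + 1).
split; first by exists 0 => //; rewrite linear0.
by move=> a _ _ [b sb <-] [c sc <-]; exists (a *: b + c); rewrite ?linearP //; exact: sl.
Qed.

(** Bases are transported by maps which are inverse to each other only modulo the boundaries, as
    homotopy equivalences are. The size n is fixed because [dim_mod] is an infimum over all sizes of
    bases. *)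
Lemma dim_mod_le M N (Z B : set M) (Z' B' : set N)
    (f : {linear M -> N}) (g : {linear N -> M}) n :
    subspace Z -> subspace B -> subspace B' ->
    (forall z, Z z -> Z' (f z)) -> (forall b, B b -> B' (f b)) ->
    (forall z, Z' z -> Z (g z)) -> (forall b, B' b -> B (g b)) ->
    (forall z, Z z -> B (g (f z) - z)) -> (forall z, Z' z -> B' (f (g z) - z)) ->
  (exists z : 'I_n -> M, basis_mod Z B z) ->
  exists z : 'I_n -> N, basis_mod Z' B' z.
Proof.
move=> sZ sB sB' fZ fB gZ gB gf fg [z [Zz gen_z free_z]].
exists (f \o z); have fs a : f (\sum_j a j *: z j) = \sum_j a j *: (f \o z) j.
  by rewrite linear_sum; apply: eq_bigr => j _; rewrite linearZ.
split=> [j|c Zc|a].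
- exact/fZ/Zz.
- have [a Ba] := gen_z _ (gZ _ Zc); exists a; rewrite -fs.
  have := subspaceB sB' (fB _ Ba) (fg _ Zc); rewrite linearB /= opprB addrC addrA.
  by rewrite subrK.
- rewrite -fs => /gB Ba; apply: free_z.
  have := subspaceB sB Ba (gf _ (subspace_sum a sZ Zz)).
  by rewrite opprB addrC subrK.
Qed.

Lemma dim_mod_iso (R : realType) M N (Z B : set M) (Z' B' : set N)
    (f : {linear M -> N}) (g : {linear N -> M}) :
    subspace Z -> subspace B -> subspace Z' -> subspace B' ->
    (forall z, Z z -> Z' (f z)) -> (forall b, B b -> B' (f b)) ->
    (forall z, Z' z -> Z (g z)) -> (forall b, B' b -> B (g b)) ->
    (forall z, Z z -> B (g (f z) - z)) -> (forall z, Z' z -> B' (f (g z) - z)) ->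
  dim_mod R Z B = dim_mod R Z' B'.
Proof.
move=> sZ sB sZ' sB' fZ fB gZ gB gf fg; rewrite /dim_mod.
suff -> : [set n | exists z : 'I_n -> M, basis_mod Z B z]%classic =
          [set n | exists z : 'I_n -> N, basis_mod Z' B' z]%classic by [].
apply/seteqP; split=> n /=; first exact: (dim_mod_le (f := f) (g := g)).
exact: (dim_mod_le (f := g) (g := f)).
Qed.

End FreeModules.

(* A free H-set with its orbit map: [coord x] is the element of H which carries
   the chosen representative of the orbit of x to x. *)
Record free_gset (H : groupType) := FreeGset {
  point : choiceType;
  orbit : choiceType;
  gact : H -> point -> point;
  orb : point -> orbit;
  orb_repr : orbit -> point;
  coord : point -> H;
  gactM : forall g h x, gact (g * h)%g x = gact g (gact h x);
  orb_gact : forall g x, orb (gact g x) = orb x;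
  orb_reprK : forall y, orb (orb_repr y) = y;
  coord_gact : forall g x, coord (gact g x) = (g * coord x)%g;
  gact_coord : forall x, gact (coord x) (orb_repr (orb x)) = x }.

(** * Equivariant maps and coinvariants *)

Section FreeGsets.
Variables (F : fieldType) (H : groupType).
Implicit Types X Y : free_gset H.

Local Notation "''F' X" := {freeg (point X) / F} (at level 0, X at level 0).

Definition lact X (g : H) : 'F X -> 'F X := fglift (fun x => << gact g x >>).

Definition equivariant X Y (f : point X -> 'F Y) : Prop :=
  forall g x, f (gact g x) = lact g (f x).

Definition orbm X : 'F X -> {freeg (orbit X) / F} := fglift (fun x => << orb x >>).

(** The map induced on the coinvariants, of which the orbits form a basis. For an equivariant [f]
    the choice of the representative does not matter. *)
Definition down X Y (f : point X -> 'F Y) (y : orbit X) : {freeg (orbit Y) / F} :=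
  orbm (f (orb_repr y)).

Definition equi_ext X Y (f : orbit X -> 'F Y) (x : point X) : 'F Y :=
  lact (coord x) (f (orb x)).

Lemma lactM X g h (c : 'F X) : lact (g * h)%g c = lact g (lact h c).
Proof.
rewrite /lact linear_fglift /=; apply: eq_fglift => x.
by rewrite fglift1 gactM.
Qed.

Lemma gact1 X (x : point X) : gact 1%g x = x.
Proof. by rewrite -(gact_coord x) -gactM mul1g. Qed.

Lemma lact1 X (c : 'F X) : lact 1%g c = c.
Proof. by rewrite /lact -[RHS]fgliftU; apply: eq_fglift => x; rewrite gact1. Qed.

Lemma equi_ext_equivariant X Y (f : orbit X -> 'F Y) : equivariant (equi_ext f).
Proof. by move=> g x; rewrite /equi_ext coord_gact lactM orb_gact. Qed.

Lemma fglift_lact X Y (f : point X -> 'F Y) : equivariant f ->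
  forall g c, fglift f (lact g c) = lact g (fglift f c).
Proof.
move=> ef g c; rewrite /lact !linear_fglift /=; apply: eq_fglift => x.
by rewrite fglift1 ef.
Qed.

Lemma equivariantU X : equivariant (fun x : point X => << x >>).
Proof. by move=> g x; rewrite /lact fglift1. Qed.

Lemma equivariant_comp X Y Z (f : point X -> 'F Y) (g : point Y -> 'F Z) :
  equivariant f -> equivariant g -> equivariant (fun x => fglift g (f x)).
Proof. by move=> ef eg h x; rewrite ef fglift_lact. Qed.

Lemma orbm_lact X g (c : 'F X) : orbm (lact g c) = orbm c.
Proof.
rewrite /orbm /lact linear_fglift /=; apply: eq_fglift => x.
by rewrite fglift1 orb_gact.
Qed.

Lemma orbm_down X Y (f : point X -> 'F Y) : equivariant f ->
  forall c, orbm (fglift f c) = fglift (down f) (orbm c).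
Proof.
move=> ef c; rewrite /orbm !linear_fglift /=; apply: eq_fglift => x.
by rewrite fglift1 -{1}(gact_coord x) ef -/(orbm _) orbm_lact.
Qed.

Lemma on_lact X (A : orbit X -> Prop) g (c : 'F X) :
  on (fun x => A (orb x)) c -> on (fun x => A (orb x)) (lact g c).
Proof.
move=> Ac; apply: on_fglift Ac _ => x Ax; apply: onU; by rewrite orb_gact.
Qed.

Lemma on_orbm X (A : orbit X -> Prop) (c : 'F X) :
  on (fun x => A (orb x)) c -> on A (orbm c).
Proof. by move=> Ac; apply: on_fglift Ac _ => x Ax; exact: onU. Qed.

End FreeGsets.

(** * Successive choices along a degree *)

Section DegreeRecursion.
Variables (Y : Type) (T : choiceType) (t0 : T) (deg : Y -> nat).
Variable Q : (Y -> T) -> Y -> T -> Prop.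
Hypothesis Q_local : forall f g y t,
  (forall y', (deg y' < deg y)%N -> f y' = g y') -> Q f y t -> Q g y t.
Hypothesis Q_ex : forall f y,
  (forall y', (deg y' < deg y)%N -> Q f y' (f y')) -> exists t, Q f y t.

(** [Q f y t] accepts the value t at y in view of the values of f in lower degrees, so the choices
    cannot be made at each y independently. *)
Lemma degree_recursion : exists f, forall y, Q f y (f y).
Proof.
pose C f y := xget t0 [set t | Q f y t]%classic.
(* [phi n] is final in degrees below n; the values of degree n are chosen relative to it and kept
   from then on. *)
pose phi := fix phi n := if n is m.+1 then
  fun y => if (deg y < m)%N then phi m y else C (phi m) y else fun=> t0.
have phiS n y : phi n.+1 y = if (deg y < n)%N then phi n y else C (phi n) y by [].
have stable n m y : (deg y < m <= n)%N -> phi n y = phi m y.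
  elim: n => [|n IHn] /andP[ym]; first by rewrite leqn0 => /eqP m0; rewrite m0 in ym.
  rewrite leq_eqVlt => /orP[/eqP-> //|mn]; rewrite phiS (leq_trans ym) //.
  by rewrite IHn // ym.
exists (fun y => phi (deg y).+1 y) => y.
have [n] := ubnP (deg y); elim: n y => // n IHn y ltyn.
have agree y' : (deg y' < deg y)%N -> phi (deg y) y' = phi (deg y').+1 y'.
  by move=> lt; apply: stable; rewrite ltnSn.
have [t Qt] : exists t, Q (phi (deg y)) y t.
  apply: Q_ex => y' lt; rewrite agree //.
  apply: Q_local (IHn y' (leq_trans lt _)) => // y'' lt'.
  by rewrite agree // (ltn_trans lt').
apply: (Q_local (f := phi (deg y))) => //.
by rewrite phiS ltnn /C; case: xgetP => [t' _ //|/(_ t)].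
Qed.

End DegreeRecursion.

(** * Comparison of free resolutions *)

Section Resolutions.
Variables (F : fieldType) (H : groupType).

Definition cells (X : free_gset H) (P : pred (orbit X)) (deg : orbit X -> nat)
    (n : nat) (x : point X) : Prop :=
  P (orb x) /\ deg (orb x) = n.

Definition augm (X : free_gset H) (deg : orbit X -> nat) :
    {freeg (point X) / F} -> F^o :=
  fglift (fun x => (deg (orb x) == 0%N)%:R : F^o).

(* A complex of free F[H]-modules on the points x of degree [deg (orb x)] with
   [P (orb x)], which is exact and augmented by F in degree -1. *)
Record resolution (X : free_gset H) (P : pred (orbit X)) (deg : orbit X -> nat)
    (d : point X -> {freeg (point X) / F}) : Prop := Resolution {
  res_equi : equivariant d;
  res_on : forall x, P (orb x) ->
    on (fun x' => P (orb x') /\ (deg (orb x')).+1 = deg (orb x)) (d x);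
  res_dd : forall x, P (orb x) -> fglift d (d x) = 0;
  res_aug : forall x, P (orb x) -> augm deg (d x) = 0;
  res_exact : forall n c, on (cells P deg n) c -> fglift d c = 0 -> augm deg c = 0 ->
    exists2 b, on (cells P deg n.+1) b & fglift d b = c;
  res_base : exists x, cells P deg 0 x }.

Section Maps.
Variables X Y : free_gset H.
Variables (P : pred (orbit X)) (deg : orbit X -> nat).
Variables (P' : pred (orbit Y)) (deg' : orbit Y -> nat).
Variables (d : point X -> {freeg (point X) / F}) (d' : point Y -> {freeg (point Y) / F}).
Hypotheses (resX : resolution P deg d) (resY : resolution P' deg' d').

(** The condition on [augm] says that f lifts the identity of F; in positive degrees both of its
    sides vanish. *)
Definition chain_map (f : point X -> {freeg (point Y) / F}) : Prop :=
  equivariant f /\ forall x, P (orb x) ->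
  [/\ on (cells P' deg' (deg (orb x))) (f x),
      augm deg' (f x) = (deg (orb x) == 0%N)%:R
    & fglift d' (f x) = fglift f (d x)].

Lemma res_d0 x : P (orb x) -> deg (orb x) = 0%N -> d x = 0.
Proof.
by move=> Px x0; apply: on_empty (res_on resX Px) _ => x' [_]; rewrite x0.
Qed.

Lemma augm_eq0 n c : on (cells P' deg' n.+1) c -> augm deg' c = 0.
Proof. by move=> Ac; apply: fglift_eq0_on Ac _ => x [_ ->]. Qed.

Lemma augm_lact g (c : {freeg (point Y) / F}) : augm deg' (lact g c) = augm deg' c.
Proof.
rewrite /augm /lact linear_fglift /=; apply: eq_fglift => x.
by rewrite fglift1 orb_gact.
Qed.

Lemma on_cells_lact g n c :
  on (cells P' deg' n) c -> on (cells P' deg' n) (lact (F := F) g c).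
Proof. exact: (@on_lact F H Y (fun y => P' y /\ deg' y = n)). Qed.

Lemma eq_equi_ext_bd f g y : P y ->
  (forall y', (deg y' < deg y)%N -> f y' = g y') ->
  fglift (equi_ext f) (d (orb_repr y)) =
  fglift (equi_ext g) (d (orb_repr y)) :> {freeg (point Y) / F}.
Proof.
move=> Py fg; have Pr : P (orb (orb_repr y)) by rewrite orb_reprK.
apply: eq_fglift_on (res_on resX Pr) _ => x [_]; rewrite orb_reprK => degx.
by rewrite /equi_ext fg // -degx.
Qed.

(** The value on an orbit representative is a preimage, by exactness of the target, of the cycle
    obtained from its boundary; translation extends it to the orbit. In degree 0 a fixed base point
    of the target serves for all orbits. *)
Lemma chain_map_ex : exists f, chain_map f.
Proof.
have [x0 [Px0 degx0]] := res_base resY.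
pose Q (f : orbit X -> {freeg (point Y) / F}) y m := P y ->
  [/\ on (cells P' deg' (deg y)) m, augm deg' m = (deg y == 0%N)%:R
    & fglift d' m = fglift (equi_ext f) (d (orb_repr y))].
have [f fQ] : exists f, forall y, Q f y (f y).
  apply: (degree_recursion (0 : {freeg (point Y) / F}) (deg := deg)) => [f g y t fg Qt Py|f y Qf].
    by have [? ? ->] := Qt Py; split=> //; exact: eq_equi_ext_bd.
  rewrite /Q; have [Py|] := boolP (P y); last by exists 0.
  have Pr : P (orb (orb_repr y)) by rewrite orb_reprK.
  case degy: (deg y) => [|n].
    exists << x0 >> => _; split; first exact: onU.
      by rewrite /augm fglift1 degx0.
    rewrite fglift1 (res_d0 (x := orb_repr y)) // ?orb_reprK // linear0.
    by apply: on_empty (res_on resY Px0) _ => x' [_]; rewrite degx0.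
  have Qx x : cells P deg n x -> [/\ on (cells P' deg' n) (equi_ext f x),
     augm deg' (equi_ext f x) = (n == 0%N)%:R
     & fglift d' (equi_ext f x) = fglift (equi_ext f) (d x)].
    move=> [Px degx]; have [|//|] := Qf (orb x); first by rewrite degx degy.
    rewrite degx => onx augx dx; split.
    - exact: on_cells_lact.
    - by rewrite augm_lact.
    - rewrite [in LHS]/equi_ext (fglift_lact (res_equi resY)) dx.
      rewrite -fglift_lact; last exact: equi_ext_equivariant.
      by rewrite -(res_equi resX) gact_coord.
  have ond : on (cells P deg n) (d (orb_repr y)).
    apply: on_imp (res_on resX Pr) _ => x [Px]; rewrite orb_reprK degy => -[e].
    by split.
  have onc : on (cells P' deg' n) (fglift (equi_ext f) (d (orb_repr y))).
    by apply: on_fglift ond _ => x /Qx[].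
  have [||b onb db] := res_exact resY onc.
  - rewrite linear_fglift /=.
    rewrite (eq_fglift_on (g := fun x => fglift (equi_ext f) (d x)) ond).
      by rewrite -linear_fglift /= (res_dd resX) // linear0.
    by move=> x /Qx[].
  - rewrite /augm linear_fglift /= -/(augm deg').
    rewrite -[RHS](res_aug resX Pr); apply: eq_fglift_on ond _ => x /[dup] [[_ ->]].
    by move=> /Qx[].
  by exists b => _; split=> //; exact: augm_eq0 onb.
exists (equi_ext f); split=> [|x Px]; first exact: equi_ext_equivariant.
have [onx augx dx] := fQ _ Px; split.
- exact: on_cells_lact.
- by rewrite augm_lact.
- rewrite [in LHS]/equi_ext (fglift_lact (res_equi resY)) dx.
  rewrite -fglift_lact; last exact: equi_ext_equivariant.
  by rewrite -(res_equi resX) gact_coord.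
Qed.

(** The equation for [s x] is again solved by exactness. In degree 0 the difference of f and g is a
    boundary because both lift the same map of F. *)
Lemma chain_homotopy_ex f g : chain_map f -> chain_map g ->
  exists s, equivariant s /\ forall x, P (orb x) ->
    on (cells P' deg' (deg (orb x)).+1) (s x) /\
    fglift d' (s x) = f x - g x - fglift s (d x).
Proof.
move=> [ef mf] [eg mg].
pose Q (s : orbit X -> {freeg (point Y) / F}) y m := P y ->
  on (cells P' deg' (deg y).+1) m /\
  fglift d' m = f (orb_repr y) - g (orb_repr y) - fglift (equi_ext s) (d (orb_repr y)).
have Qx s x : P (orb x) -> Q s (orb x) (s (orb x)) ->
    on (cells P' deg' (deg (orb x)).+1) (equi_ext s x) /\
    fglift d' (equi_ext s x) = f x - g x - fglift (equi_ext s) (d x).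
  move=> Px /(_ Px)[onx dx]; split; first exact: on_cells_lact.
  rewrite [in LHS]/equi_ext (fglift_lact (res_equi resY)) dx /lact !linearB /= -/(lact _).
  rewrite -!/(lact _ _) -ef -eg -fglift_lact; last exact: equi_ext_equivariant.
  by rewrite -(res_equi resX) gact_coord.
have [s sQ] : exists s, forall y, Q s y (s y).
  apply: (degree_recursion (0 : {freeg (point Y) / F}) (deg := deg)) => [s t y m st Qm Py|s y Qs].
    by have [? ->] := Qm Py; split=> //; rewrite (eq_equi_ext_bd Py st).
  rewrite /Q; have [Py|] := boolP (P y); last by exists 0.
  set x := orb_repr y; have Px : P (orb x) by rewrite orb_reprK.
  have degx : deg (orb x) = deg y by rewrite orb_reprK.
  have := res_on resX Px; rewrite degx => ond.
  have [onf augf df] := mf _ Px; have [ong augg dg] := mg _ Px.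
  have sx z : P (orb z) /\ (deg (orb z)).+1 = deg y ->
      on (cells P' deg' (deg y)) (equi_ext s z) /\
      fglift d' (equi_ext s z) = f z - g z - fglift (equi_ext s) (d z).
    by move=> [Pz degz]; rewrite -{1}degz; apply: Qx => //; apply: Qs; rewrite -degz.
  have ons : on (cells P' deg' (deg y)) (fglift (equi_ext s) (d x)).
    by apply: on_fglift ond _ => z /sx[].
  rewrite degx in onf ong augf augg.
  have [|||b onb db] := @res_exact _ _ _ _ resY (deg y)
      (f x - g x - fglift (equi_ext s) (d x)).
  - by apply: onB => //; exact: onB.
  - rewrite !linearB /= df dg [X in _ - X]linear_fglift /=.
    rewrite (eq_fglift_on (f := fun z => fglift d' (equi_ext s z))
      (g := fun z => f z - g z - fglift (equi_ext s) (d z)) ond).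
      by rewrite !fglift_sub -linear_fglift /= (res_dd resX) // linear0 subr0 subrr.
    by move=> z /sx[].
  - rewrite /augm !linearB /= -!/(augm deg' _) augf augg subrr sub0r.
    case degy: (deg y) ons => [|n] ons; last by rewrite (augm_eq0 ons) oppr0.
    by rewrite (res_d0 Px) ?degx // linear0 /augm linear0 oppr0.
  by exists b.
exists (equi_ext s); split=> [|x Px]; first exact: equi_ext_equivariant.
exact: Qx.
Qed.

End Maps.
End Resolutions.

(** * Group homology does not depend on the resolution *)

Section Coinvariants.
Variables (R : realType) (F : fieldType) (H : groupType).

Section Down.
Variables X Y : free_gset H.
Variables (P : pred (orbit X)) (deg : orbit X -> nat).
Variables (P' : pred (orbit Y)) (deg' : orbit Y -> nat).
Variables (d : point X -> {freeg (point X) / F}) (d' : point Y -> {freeg (point Y) / F}).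
Hypotheses (resX : resolution P deg d) (resY : resolution P' deg' d').

Local Notation zdeg := (fun y => (deg y)%:Z).
Local Notation zdeg' := (fun y => (deg' y)%:Z).

Lemma chains_down (f : point X -> {freeg (point Y) / F}) n m z :
    (forall x, cells P deg n x -> on (cells P' deg' m) (f x)) ->
  chains P zdeg n%:Z z -> chains P' zdeg' m%:Z (fglift (down f) z).
Proof.
move=> onf cz; apply: on_fglift cz _ => y [Py [degy]].
apply: (on_imp (A := fun y' => P' y' /\ deg' y' = m)); last by move=> ? [? ->].
by apply: on_orbm; apply: onf; split; rewrite orb_reprK.
Qed.

Lemma down_bd (f : point X -> {freeg (point Y) / F}) n z :
    chain_map P deg P' deg' d d' f -> chains P zdeg n%:Z z ->
  fglift (down d') (fglift (down f) z) = fglift (down f) (fglift (down d) z).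
Proof.
move=> [ef mf] cz; rewrite !linear_fglift /=; apply: eq_fglift_on cz _ => y [Py _].
rewrite -!orbm_down //; last exact: (res_equi resY).
by have [|_ _ ->] := mf (orb_repr y); rewrite ?orb_reprK.
Qed.

Lemma cycles_down (f : point X -> {freeg (point Y) / F}) n z :
    chain_map P deg P' deg' d d' f -> cycles P zdeg (down d) n%:Z z ->
  cycles P' zdeg' (down d') n%:Z (fglift (down f) z).
Proof.
move=> mf [cz dz]; split.
  by apply: chains_down cz => x [Px <-]; have [] := mf.2 _ Px.
by rewrite /= (down_bd mf cz) dz linear0.
Qed.

Lemma boundaries_down (f : point X -> {freeg (point Y) / F}) n z :
    chain_map P deg P' deg' d d' f -> boundaries P zdeg (down d) n%:Z z ->
  boundaries P' zdeg' (down d') n%:Z (fglift (down f) z).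
Proof.
rewrite /boundaries -PoszD addn1 => mf [c cc <-]; exists (fglift (down f) c).
  by apply: chains_down cc => x [Px <-]; have [] := mf.2 _ Px.
by rewrite (down_bd mf cc).
Qed.

Lemma homotopic_down (f g : point X -> {freeg (point Y) / F}) n z :
    chain_map P deg P' deg' d d' f -> chain_map P deg P' deg' d d' g ->
    cycles P zdeg (down d) n%:Z z ->
  boundaries P' zdeg' (down d') n%:Z (fglift (down f) z - fglift (down g) z).
Proof.
move=> mf mg [cz dz]; have [s [es ds]] := chain_homotopy_ex resX resY mf mg.
rewrite /boundaries -PoszD addn1; exists (fglift (down s) z).
  by apply: chains_down cz => x [Px <-]; have [] := ds _ Px.
rewrite linear_fglift /=.
transitivity (fglift (fun y => down f y - down g y - fglift (down s) (down d y)) z).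
  apply: eq_fglift_on cz _ => y [Py _].
  rewrite -orbm_down; last exact: (res_equi resY).
  have [|_ ->] := ds (orb_repr y); first by rewrite orb_reprK.
  by rewrite /orbm !linearB /= -!/(orbm _) (orbm_down es).
by rewrite !fglift_sub -[X in _ - X]linear_fglift /= dz linear0 subr0.
Qed.

End Down.

Lemma chain_map_id (X : free_gset H) P deg (d : point X -> {freeg (point X) / F}) :
    resolution P deg d ->
  chain_map P deg P deg d d (fun x => << x >> : {freeg (point X) / F}).
Proof.
move=> res; split=> [|x Px]; first exact: equivariantU.
by split; [exact: onU|rewrite /augm fglift1|rewrite fglift1 fgliftU].
Qed.

Lemma chain_map_comp (X Y Z : free_gset H) P deg (d : point X -> {freeg (point X) / F})
    P' deg' (d' : point Y -> {freeg (point Y) / F})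
    P'' deg'' (d'' : point Z -> {freeg (point Z) / F})
    (f : point X -> {freeg (point Y) / F}) (g : point Y -> {freeg (point Z) / F}) :
    resolution P deg d ->
    chain_map P deg P' deg' d d' f -> chain_map P' deg' P'' deg'' d' d'' g ->
  chain_map P deg P'' deg'' d d'' (fun x => fglift g (f x)).
Proof.
move=> res [ef mf] [eg mg]; split=> [|x Px]; first exact: equivariant_comp.
have [onf augf df] := mf _ Px; split.
- by apply: on_fglift onf _ => y [Py <-]; have [] := mg _ Py.
- rewrite -augf /augm linear_fglift /=; apply: eq_fglift_on onf _ => y [Py _].
  by have [] := mg _ Py.
- rewrite linear_fglift /= -[RHS]linear_fglift /= -df linear_fglift /=.
  by apply: eq_fglift_on onf _ => y [Py _]; have [] := mg _ Py.
Qed.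

(** Lifts of the identity in both directions compose to maps homotopic to the identity, and
    equivariant homotopies pass to the orbits. *)
Theorem betti_resolution (X Y : free_gset H) P deg (d : point X -> {freeg (point X) / F})
    P' deg' (d' : point Y -> {freeg (point Y) / F}) (n : nat) :
    resolution P deg d -> resolution P' deg' d' ->
  betti R P (fun y => (deg y)%:Z) (down d) n%:Z =
  betti R P' (fun y => (deg' y)%:Z) (down d') n%:Z.
Proof.
move=> resX resY.
have [f mf] := chain_map_ex resX resY; have [g mg] := chain_map_ex resY resX.
have id_down Z (z : {freeg (orbit Z) / F}) :
    fglift (down (fun x : point Z => << x >>)) z = z.
  rewrite -[RHS]fgliftU; apply: eq_fglift => y.
  by rewrite /down /orbm fglift1 orb_reprK.
have comp_down (Z W : free_gset H) (h : point Z -> {freeg (point W) / F})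
    (k : point W -> {freeg (point Z) / F}) z : equivariant k ->
    fglift (down (fun x => fglift k (h x))) z = fglift (down k) (fglift (down h) z).
  by move=> ek; rewrite linear_fglift /=; apply: eq_fglift => y; rewrite -orbm_down.
have mgf := chain_map_comp resX mf mg; have mfg := chain_map_comp resY mg mf.
apply: (@dim_mod_iso _ _ _ _ _ _ _ _ (fglift (down f)) (fglift (down g)));
  [exact: subspace_cycles|exact: subspace_boundaries
  |exact: subspace_cycles|exact: subspace_boundaries|..] => z Hz.
- exact: cycles_down Hz.
- exact: boundaries_down Hz.
- exact: cycles_down Hz.
- exact: boundaries_down Hz.
- have := homotopic_down resX resX mgf (chain_map_id resX) Hz.
  by rewrite id_down comp_down //; case: mg.
- have := homotopic_down resY resY mfg (chain_map_id resY) Hz.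
  by rewrite id_down comp_down //; case: mf.
Qed.

End Coinvariants.

(** * The bar resolution *)

Section Bar.
Variables (F : fieldType) (H : groupType).

Definition bar_gset : free_gset H.
Proof.
by apply: (@FreeGset H (H * seq H)%type (seq H) (fun g x => (g * x.1, x.2)%g)
  snd (pair 1%g) fst) => [g h [k s]|g [k s]|s|g [k s]|[k s]] //=; rewrite ?mulgA ?mulg1.
Defined.

Local Notation bar := {freeg (H * seq H)%type / F}.
Local Notation act := (@lact F H bar_gset).

(** The boundary of 1 [s]. Only the face 0 leaves the chosen representatives: it is translated by
    the first entry. *)
Definition bar_bd1 (s : seq H) : bar :=
  if s is g :: s' then << (g, s') >> +
    \sum_(k < size s) (-1) ^+ k.+1 *: << (1%g, nerve_face k.+1 s) >>
  else 0.

Definition bar_bd (x : H * seq H) : bar := act x.1 (bar_bd1 x.2).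

Lemma bar_bdE g s : bar_bd (g, s) = act g (bar_bd1 s). Proof. by []. Qed.

(** The contracting homotopy g [s] -> 1 [g | s], which is linear over F but not equivariant. *)
Definition bar_cone : bar -> bar := fglift (fun x => << (1%g, x.1 :: x.2) >>).

Definition bar_aug : bar -> F^o := @augm F H bar_gset size.

Lemma nerve_face_cons g h (s : seq H) k : (k < size (h :: s))%N ->
  nerve_face k.+2 [:: g, h & s] = g :: nerve_face k.+1 (h :: s).
Proof. by move=> lt; rewrite /nerve_face /= eqSS; case: ifP. Qed.

(** The homotopy identity of the cone, read as a recursion for the boundary; the last term is the
    augmentation. Exactness and d d = 0 both follow from it, so the simplicial identities need not
    be checked. *)
Lemma bar_bd1_cons g s : bar_bd1 (g :: s) =
  << (g, s) >> - bar_cone (act g (bar_bd1 s)) - (size s == 0%N)%:R *: << (1%g, [::]) >>.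
Proof.
case: s => [|h s].
  by rewrite /bar_bd1 /= big_ord1 /lact /bar_cone !linear0 addr0 scale1r expr1 scaleN1r.
rewrite [in LHS]/bar_bd1 big_ord_recl /= scale0r subr0; congr (_ + _).
rewrite /bar_cone /lact 2!linearD !linear_sum /= !fglift1 /= opprD -sumrN.
rewrite expr1 scaleN1r; congr (_ + _); first by rewrite /nerve_face /= drop0.
apply: eq_bigr => k _.
rewrite !linearZ /= !fglift1 /= mulg1 scalerN -scaleNr.
by rewrite [bump 0 k]add1n exprS mulN1r nerve_face_cons.
Qed.

Lemma bar_bd_cone (c : bar) :
  fglift bar_bd (bar_cone c) = c - bar_cone (fglift bar_bd c) - bar_aug c *: << (1%g, [::]) >>.
Proof.
transitivity (fglift (fun x => << x >> - bar_cone (bar_bd x) -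
    (size x.2 == 0%N)%:R *: << (1%g, [::]) >> : bar) c).
  rewrite /bar_cone linear_fglift /=; apply: eq_fglift => -[g s].
  by rewrite fglift1 !bar_bdE [act 1%g _]lact1 bar_bd1_cons.
rewrite !fglift_sub fgliftU; congr (_ - _ - _).
  by rewrite /bar_cone [RHS]linear_fglift.
rewrite /bar_aug /augm !fgliftE scaler_suml; apply: eq_bigr => x _.
by rewrite scalerA.
Qed.

Lemma bar_bd_equivariant : @equivariant F H bar_gset bar_gset bar_bd.
Proof. by move=> g [h s]; rewrite /bar_bd /= [LHS]lactM. Qed.

Lemma bar_bd_on (x : H * seq H) :
  on (fun y : H * seq H => (size y.2).+1 = size x.2) (bar_bd x).
Proof.
case: x => g s; apply: (@on_lact F H bar_gset (fun t => (size t).+1 = size s)).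
case: s => [|h s] /=; first exact: on0.
apply: onD; first exact: onU.
apply: on_sum => k _; apply: onZ; apply: onU; rewrite /nerve_face /=.
have := ltn_ord k; rewrite [X in (_ < X)%N]/= ltnS eqSS; case: eqVneq => [->|ne] le.
  by rewrite size_takel.
have lt : (k < size s)%N by rewrite ltn_neqAle ne.
rewrite size_cat size_take /= size_drop ltnS le.
by rewrite -[in RHS](subnKC lt) addSnnS.
Qed.

Lemma bar_aug_cone c : bar_aug (bar_cone c) = 0.
Proof.
rewrite /bar_aug /augm /bar_cone linear_fglift /= fgliftE big1 // => x _.
by rewrite fglift1 scaler0.
Qed.

Lemma bar_aug_bd (x : H * seq H) : bar_aug (bar_bd x) = 0.
Proof.
case: x => g s; rewrite [LHS](@augm_lact F H bar_gset); case: s => [|h s].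
  by rewrite /augm linear0.
rewrite bar_bd1_cons /augm !linearB linearZ /= !fglift1 /=.
by rewrite [fglift _ (bar_cone _)]bar_aug_cone subr0 [_ *: _]mulr1 subrr.
Qed.

Lemma bar_bd_bd (x : H * seq H) : fglift bar_bd (bar_bd x) = 0.
Proof.
case: x => g s.
rewrite [LHS](@fglift_lact F H bar_gset bar_gset _ bar_bd_equivariant) /=.
suff -> : fglift bar_bd (bar_bd1 s) = 0 by rewrite /lact linear0.
elim: s => [|h s IHs]; first by rewrite linear0.
rewrite bar_bd1_cons !linearB linearZ /= !fglift1 bar_bd_cone.
have -> : bar_bd (1%g, [::]) = 0 by rewrite /bar_bd /= /lact linear0.
rewrite scaler0 subr0.
rewrite [bar_aug _](bar_aug_bd (h, s)) scale0r subr0 opprB addrC subrK.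
rewrite [fglift _ _](@fglift_lact F H bar_gset bar_gset _ bar_bd_equivariant) /=.
by rewrite IHs /bar_cone /lact !linear0.
Qed.

Lemma bar_resolution : @resolution F H bar_gset xpredT size bar_bd.
Proof.
split=> [|x _|x _|x _|n c onc dc augc|].
- exact: bar_bd_equivariant.
- by move=> y /bar_bd_on.
- exact: bar_bd_bd.
- exact: bar_aug_bd.
- exists (bar_cone c); last first.
    by rewrite bar_bd_cone dc /bar_cone linear0 subr0 [bar_aug c]augc scale0r subr0.
  by apply: on_fglift onc _ => x [_ <-]; exact: onU.
- by exists (1%g, [::]).
Qed.

Lemma down_bar s : @down F H bar_gset bar_gset bar_bd s = nerve_bd F s.
Proof.
rewrite /down /bar_bd /= [act _ _]lact1 /nerve_bd; case: s => [|g s].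
  by rewrite /orbm linear0.
rewrite /orbm linearD linear_sum /= fglift1 [in RHS]big_ord_recl expr0 scale1r; congr (_ + _).
by apply: eq_bigr => k _; rewrite linearZ /= fglift1.
Qed.

End Bar.

(** * Koszul-type complexes with signs from an order of the vertices *)

Section Koszul.
Variables (F : fieldType) (V : finType) (L : {set {set V}}).
Hypothesis hL : simplicial_complex L.
Local Notation adj := (adjacent L).
Implicit Types (s : {set V}) (v w : V).

Definition sgn s v : F :=
  (-1) ^+ #|[set w in s | (enum_rank w < enum_rank v)%N]%SET|.

Lemma sgnK s v : sgn s v * sgn s v = 1.
Proof. by rewrite /sgn -expr2 sqrr_sign. Qed.

Lemma sgnD1 s v w : v \in s -> v != w ->
  sgn (s :\ v)%SET w = (if (enum_rank v < enum_rank w)%N then -1 else 1) * sgn s w.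
Proof.
move=> vs nvw; rewrite /sgn; set A := [set u in s | _]%SET; set B := [set u in _ | _]%SET.
have -> : B = (A :\ v)%SET by apply/setP => u; rewrite !inE andbA.
rewrite [in RHS](cardsD1 v) [v \in A]inE vs /=.
by case: ltnP => _; rewrite ?mul1r // exprS mulrA mulN1r opprK mul1r.
Qed.

Lemma sgn_swap s v w : v \in s -> w \in s -> v != w ->
  sgn s v * sgn (s :\ v)%SET w = - (sgn s w * sgn (s :\ w)%SET v).
Proof.
move=> vs ws nvw; have nwv : w != v by rewrite eq_sym.
rewrite !sgnD1 //; case: ltngtP => [_|_|/val_inj/enum_rank_inj e].
- by rewrite mul1r mulN1r mulrN mulrC.
- by rewrite mul1r mulN1r mulrN opprK mulrC.
by rewrite e eqxx in nvw.
Qed.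

(** The variant of [sgn_swap] for a face in one direction combined with a coface in the other. *)
Lemma sgn_swapC s v w : v \in s -> w \in s -> v != w ->
  sgn s w * sgn s v = - (sgn (s :\ w)%SET v * sgn (s :\ v)%SET w).
Proof.
move=> vs ws nvw; have nwv : w != v by rewrite eq_sym.
rewrite !sgnD1 //; case: ltngtP => [_|_|/val_inj/enum_rank_inj e].
- by rewrite mul1r mulN1r mulNr opprK mulrC.
- by rewrite mul1r mulN1r mulrN opprK mulrC.
by rewrite e eqxx in nvw.
Qed.

Lemma sum_antisym (M : zmodType) s (a : V -> V -> M) :
  (forall v w, v \in s -> w \in s -> v != w -> a v w = - a w v) ->
  \sum_(v in s) \sum_(w in (s :\ v)%SET) a v w = 0.
Proof.
move=> aN.
transitivity (\sum_(v in s) (\sum_(w in s | (enum_rank w < enum_rank v)%N) a v w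
                  + \sum_(w in s | (enum_rank v < enum_rank w)%N) a v w)).
  apply: eq_bigr => v vs; rewrite (bigID (fun w => enum_rank w < enum_rank v)%N) /=.
  congr (_ + _); apply: eq_bigl => w; rewrite !inE.
    by have [->|ne] := eqVneq w v; rewrite ?ltnn ?andbF.
  rewrite -leqNgt leq_eqVlt [(_ : nat) == _]eq_sym.
  have [->|ne] := eqVneq w v; first by rewrite ltnn andbF.
  suff /negPf-> : enum_rank w != enum_rank v :> nat by [].
  by apply: contra_neq ne => /val_inj/enum_rank_inj.
rewrite big_split /=.
have -> : \sum_(v in s) \sum_(w in s | (enum_rank v < enum_rank w)%N) a v w =
    \sum_(v in s) \sum_(w in s | (enum_rank w < enum_rank v)%N) a w v.
  rewrite (exchange_big_dep (fun w => w \in s)) /=; last by move=> ? ? _ /andP[].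
  by apply: eq_bigr => v vs; apply: eq_bigl => w; rewrite vs.
rewrite -big_split big1 // => v vs; rewrite -big_split big1 // => w /andP[ws lt] /=.
by rewrite aN ?addNr //; apply: contraTneq lt => ->; rewrite ltnn.
Qed.

Lemma simplex_face s v : s \in L -> (s :\ v)%SET \in L.
Proof. by case: hL => _ _ sub sL; apply: sub sL _; exact: finset.subsetDl. Qed.

Lemma simplex_adjacent s v w : s \in L -> v \in s -> w \in s -> v != w -> adj v w.
Proof.
case: hL => _ _ sub sL vs ws nvw; rewrite /adjacent nvw; apply: sub sL _.
by rewrite finset.subUset !finset.sub1set vs.
Qed.

Section Operators.
Variables (X : choiceType) (act : V -> X -> X) (U : {set V}).
Hypothesis act_comm : forall v w x, adj v w -> act v (act w x) = act w (act v x).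

Local Notation cell := (X * {set V})%type.
Local Notation chain := {freeg cell / F}.

(* The face in direction v carries the coefficient [v - 1] when v \in U, as in
   the Salvetti complex, and [1] otherwise, as in the simplicial complex L. *)
Definition kos_face v x s : chain :=
  if v \in U then << (act v x, s) >> - << (x, s) >> else << (x, s) >>.

Definition kos_bd (e : cell) : chain :=
  \sum_(v in e.2) sgn e.2 v *: kos_face v e.1 (e.2 :\ v)%SET.

Definition kos_face2 v w x s : chain := fglift (fun e => kos_face w e.1 e.2) (kos_face v x s).

Lemma kos_face2C v w x s : adj v w -> kos_face2 v w x s = kos_face2 w v x s.
Proof.
have swap (M : zmodType) (a b c d : M) : a - b - (c - d) = a - c - (b - d).
  by rewrite !opprB addrACA [RHS]addrACA [- b - c]addrC.
move=> a; rewrite /kos_face2 /kos_face.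
case: (v \in U); case: (w \in U); rewrite ?linearB /= !fglift1 //=.
by rewrite (act_comm _ a); exact: swap.
Qed.

Lemma kos_bd_face v x s :
  fglift kos_bd (kos_face v x s) = \sum_(w in s) sgn s w *: kos_face2 v w x (s :\ w)%SET.
Proof.
rewrite /kos_face2 /kos_face; case: (v \in U).
  rewrite linearB /= !fglift1 /kos_bd -sumrB; apply: eq_bigr => w _.
  by rewrite linearB /= !fglift1 scalerBr.
by rewrite fglift1 /kos_bd; apply: eq_bigr => w _; rewrite fglift1.
Qed.

(** The signs of two successive faces are antisymmetric, while the coefficients commute because the
    vertices of a simplex are pairwise adjacent. *)
Lemma kos_bd_bd e : e.2 \in L -> fglift kos_bd (kos_bd e) = 0.
Proof.
case: e => x s /= sL; rewrite /kos_bd -/kos_bd linear_sum /=.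
under eq_bigr => v _ do rewrite linearZ /= kos_bd_face scaler_sumr.
under eq_bigr => v _ do under eq_bigr => w _ do rewrite scalerA.
apply: sum_antisym => v w vs ws nvw.
have a := simplex_adjacent sL vs ws nvw.
rewrite sgn_swap // scaleNr kos_face2C //; congr (- (_ *: kos_face2 _ _ _ _)).
by apply/setP => u; rewrite !inE andbCA.
Qed.

Lemma kos_bd_on e : e.2 \in L ->
  on (fun e' : cell => e'.2 \in L /\ #|e'.2|.+1 = #|e.2|) (kos_bd e).
Proof.
case: e => x s /= sL; apply: on_sum => v vs; apply: onZ.
have ok : (s :\ v)%SET \in L /\ #|(s :\ v)%SET|.+1 = #|s|.
  by rewrite simplex_face //= (cardsD1 v s) vs.
by rewrite /kos_face; case: ifP => _; [apply: onB|]; exact: onU.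
Qed.

End Operators.
End Koszul.

(** * Exactness of the Salvetti complex *)

Section Salvetti.
Variables (F : fieldType) (V : finType) (L : {set {set V}}).
Hypotheses (hL : simplicial_complex L) (hflag : flag L).
Local Notation adj := (adjacent L).
Local Notation G := (raag L).
Local Notation cell := (G * {set V})%type.
Local Notation chain := {freeg cell / F}.
Implicit Types (x : G) (s : {set V}) (v w : V) (e : cell).

(** Edges are right translations, so that they commute with the left action of a subgroup. *)
Definition rgen v x : G := (x * gen L v)%g.

Lemma rgen_comm v w x : adj v w -> rgen v (rgen w x) = rgen w (rgen v x).
Proof. by move=> a; rewrite /rgen -!mulgA gen_comm // adjacentC. Qed.

Definition sal_bd : cell -> chain := kos_bd F rgen [set: V].

(* The cube (x, s) has the vertices x * prod_(v in t) gen v for t \subset s;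
   [up x v] holds when the edges in direction v lead to longer elements, and
   [apex e] gives the beads on top of the longest vertex of e, at which every
   direction of e is a descent. *)
Definition up x v := bead x v != Some true.

Definition apex e w : option bool :=
  if w \in e.2 then Some (~~ up e.1 w)
  else if [forall v in e.2, up e.1 v ==> adj v w] then bead e.1 w else None.

(** The length of the longest vertex: from the corner, each ascending direction adds one and the
    descending ones add nothing. *)
Definition height e : nat := (len e.1 + #|[set v in e.2 | up e.1 v]%SET|)%N.

(** This face keeps the longest vertex of the cube and [loface] omits it; [coface] inverts it by
    attaching an edge which descends from the longest vertex. *)
Definition hiface v e : cell := (if up e.1 v then rgen v e.1 else e.1, (e.2 :\ v)%SET).
Definition loface v e : cell := (if up e.1 v then e.1 else rgen v e.1, (e.2 :\ v)%SET).
Definition coface w e : cell :=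
  (if apex e w == Some false then e.1 * (gen L w)^-1 else e.1, w |: e.2)%g%SET.

Lemma up_hiface s x v w : s \in L -> v \in s -> w \in s -> w != v ->
  up (hiface v (x, s)).1 w = up x w.
Proof.
move=> sL vs ws nwv; rewrite /hiface /= /up; case: ifP => // _.
by rewrite bead_adj // (simplex_adjacent hL sL vs ws) // eq_sym.
Qed.

Lemma up_loface s x v w : s \in L -> v \in s -> w \in s -> w != v ->
  up (loface v (x, s)).1 w = up x w.
Proof.
move=> sL vs ws nwv; rewrite /loface /= /up; case: ifP => // _.
by rewrite bead_adj // (simplex_adjacent hL sL vs ws) // eq_sym.
Qed.

Lemma bead_rgen_nadj x v w : up x v -> w != v -> ~~ adj v w -> bead (rgen v x) w = None.
Proof.
move=> uv nwv; apply: contraNeq => bw; apply: bead_comm bw _; last by rewrite eq_sym.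
by rewrite (gen_up uv).1.
Qed.

(** Both cubes have the same longest vertex. The cases verify that [apex] sees nothing else: moving
    up along v keeps the beads of the neighbours of v and blanks the stacks of the
    non-neighbours. *)
Lemma apex_hiface e v : e.2 \in L -> v \in e.2 -> apex (hiface v e) =1 apex e.
Proof.
case: e => x s /= sL vs w; rewrite /apex /= in_setD1.
have [->|nwv] := eqVneq w v; rewrite /= ?vs.
  rewrite ifT; last first.
    apply/'forall_implyP => u; rewrite in_setD1 => /andP[nuv us]; apply/implyP => _.
    by rewrite (simplex_adjacent hL sL us).
  rewrite /up; case: ifPn => [uv|]; first by rewrite (gen_up uv).1.
  by rewrite negbK => /eqP.
have [ws|nws] := boolP (w \in s).
  by rewrite (up_hiface _ sL vs ws nwv).
have cond : [forall u in s, up x u ==> adj u w] =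
    [forall u in (s :\ v)%SET, up (hiface v (x, s)).1 u ==> adj u w] && (up x v ==> adj v w).
  apply/'forall_implyP/andP => [all|[/'forall_implyP all av] u us].
    split; last exact: all.
    apply/'forall_implyP => u; rewrite in_setD1 => /andP[nuv us].
    by rewrite (up_hiface _ sL vs us nuv) all.
  have [->//|nuv] := eqVneq u v.
  by rewrite -(up_hiface _ sL vs us nuv) all // in_setD1 nuv.
rewrite cond; case: [forall u in _, _] => //=.
have [uv|] := boolP (up x v); last by rewrite /= /hiface.
rewrite /=; case: (boolP (adj v w)) => a; first by rewrite bead_adj.
by rewrite bead_rgen_nadj.
Qed.

Lemma up_set_face s x y v : (forall w, w \in s -> w != v -> up y w = up x w) ->
  [set w in (s :\ v) | up y w]%SET = ([set w in s | up x w] :\ v)%SET.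
Proof.
move=> uE; apply/setP => w; rewrite !inE -andbA.
by have [//|nwv] := eqVneq w v; case: (boolP (w \in s)) => //= ws; rewrite uE.
Qed.

Lemma height_hiface e v : e.2 \in L -> v \in e.2 -> height (hiface v e) = height e.
Proof.
case: e => x s /= sL vs; rewrite /height /= (@up_set_face s x); last first.
  by move=> w ws nwv; rewrite (up_hiface _ sL vs ws nwv).
rewrite [in RHS](cardsD1 v) inE vs /=; case: ifP => // uv.
by rewrite (gen_up uv).2 addSnnS.
Qed.

Lemma height_loface e v : e.2 \in L -> v \in e.2 -> (height (loface v e)).+1 = height e.
Proof.
case: e => x s /= sL vs; rewrite /height /= (@up_set_face s x); last first.
  by move=> w ws nwv; rewrite (up_loface _ sL vs ws nwv).
rewrite [in RHS](cardsD1 v) inE vs /=; case: ifPn => [uv|]; first by rewrite -addnS.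
by rewrite negbK => /eqP/gen_down->; rewrite add0n addSn.
Qed.

Lemma apex_adj e v w : e.2 \in L ->
  apex e v != None -> apex e w != None -> v != w -> adj v w.
Proof.
case: e => x s /= sL; rewrite /apex /=.
have half u t : u \in s ->
    (if [forall v in s, up x v ==> adj v t] then bead x t else None) != None ->
    u != t -> adj u t.
  move=> us; case: ifP => // /'forall_implyP all bt nut.
  have [uu|] := boolP (up x u); first by have := all u us; rewrite uu.
  by rewrite negbK => /eqP bu; apply: (bead_comm (x := x)) => //; rewrite bu.
case: (boolP (v \in s)) => vs; case: (boolP (w \in s)) => ws.
- by move=> _ _; exact: (simplex_adjacent hL sL).
- by move=> _; exact: half.
- by move=> bv _; rewrite eq_sym adjacentC; exact: half.
by case: ifP => // _ bv; case: ifP => // _; exact: bead_comm.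
Qed.

Lemma apex_in e v : v \in e.2 -> apex e v != None.
Proof. by rewrite /apex => ->. Qed.

(** The flag condition enters here: the directions of the cube and w are descents at one group
    element, so they are pairwise adjacent. *)
Lemma coface_in e w : e.2 \in L -> apex e w != None -> (coface w e).2 \in L.
Proof.
move=> sL aw; apply: hflag => u t; rewrite !inE => /orP[/eqP->|us] /orP[/eqP->|ts].
- by rewrite eqxx.
- by apply: (apex_adj sL) => //; exact: apex_in.
- by apply: (apex_adj sL) => //; exact: apex_in.
- exact: (simplex_adjacent hL sL).
Qed.

Lemma hiface_coface e w : w \notin e.2 -> apex e w != None -> hiface w (coface w e) = e.
Proof.
case: e => x s /= ws aw; rewrite /hiface /= setU1K //; congr (_, _).
have eqa : apex (x, s) w = bead x w.
  by move: aw; rewrite /apex /= (negPf ws); case: ifP.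
rewrite eqa in aw *; case bw: (bead x w) aw => [[]|] //= _.
  by rewrite /up bw.
by rewrite /up genV_down // /rgen mulgVK.
Qed.

Lemma coface_hiface e v : e.2 \in L -> v \in e.2 -> coface v (hiface v e) = e.
Proof.
case: e => x s sL vs; rewrite /coface /= apex_hiface // finset.setD1K //; congr (_, _).
by rewrite /apex /= vs; case: (up x v) => //=; rewrite /rgen mulgK.
Qed.

Lemma hifaceC e v w : e.2 \in L -> v \in e.2 -> w \in e.2 -> v != w ->
  hiface v (hiface w e) = hiface w (hiface v e).
Proof.
case: e => x s /= sL vs ws nvw; have nwv : w != v by rewrite eq_sym.
rewrite {1}/hiface (up_hiface _ sL ws vs nvw) [RHS]/hiface (up_hiface _ sL vs ws nwv).
congr (_, _); last by apply/setP => u; rewrite !inE andbCA.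
rewrite /hiface /=; case: (up x v); case: (up x w) => //.
by apply: rgen_comm; exact: (simplex_adjacent hL sL).
Qed.

Lemma apex_coface e w : e.2 \in L -> w \notin e.2 -> apex e w != None ->
  apex (coface w e) =1 apex e.
Proof.
move=> sL ws aw u; rewrite -{2}(hiface_coface ws aw) apex_hiface ?coface_in //.
exact: setU11.
Qed.

Lemma height_coface e w : e.2 \in L -> w \notin e.2 -> apex e w != None ->
  height (coface w e) = height e.
Proof.
move=> sL ws aw; rewrite -{2}(hiface_coface ws aw) height_hiface ?coface_in //.
exact: setU11.
Qed.

Lemma hiface_cofaceC e v w : e.2 \in L -> v \in e.2 -> w \notin e.2 -> apex e w != None ->
  hiface v (coface w e) = coface w (hiface v e).
Proof.
move=> sL vs ws aw; have vw : v != w by apply: contraNneq ws => <-.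
have vc : v \in (coface w e).2 by rewrite setU1r.
have wc : w \in (coface w e).2 by rewrite setU11.
have cL := coface_in sL aw.
rewrite -{2}(hiface_coface ws aw) (hifaceC cL) // coface_hiface //.
  exact: simplex_face.
by rewrite in_setD1 eq_sym vw.
Qed.

(** The sign of the high face in g_v - 1. It is read from [apex] and not from [up] because [fill]
    needs it for a direction outside the cube. *)
Definition dir e v : F := if apex e v == Some false then 1 else -1.

Lemma dirK e v : dir e v * dir e v = 1.
Proof. by rewrite /dir; case: ifP; rewrite ?mulrNN mulr1. Qed.

Lemma dir_hiface e v w : e.2 \in L -> v \in e.2 -> dir (hiface v e) w = dir e w.
Proof. by move=> sL vs; rewrite /dir apex_hiface. Qed.

Lemma dir_coface e v w : e.2 \in L -> w \notin e.2 -> apex e w != None ->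
  dir (coface w e) v = dir e v.
Proof. by move=> sL ws aw; rewrite /dir apex_coface. Qed.

Definition hi_bd e : chain := \sum_(v in e.2) (sgn F e.2 v * dir e v) *: << hiface v e >>.
Definition lo_bd e : chain := \sum_(v in e.2) (sgn F e.2 v * dir e v) *: << loface v e >>.

Lemma sal_bdE e : sal_bd e = hi_bd e - lo_bd e.
Proof.
case: e => x s; rewrite /sal_bd /kos_bd /hi_bd /lo_bd /= -sumrB.
apply: eq_bigr => v vs; rewrite -scalerBr -scalerA; congr (_ *: _).
rewrite /kos_face inE /dir /apex /= vs /hiface /loface /=.
by case: (up x v) => /=; rewrite ?scale1r // scaleN1r opprB.
Qed.

(** [pick] depends only on the predicate, so all cubes with the same longest vertex share one pivot,
    the cone point of their simplex of descents. *)
Definition pivot e : option V := [pick w | apex e w != None].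

Lemma eq_pivot e e' : apex e =1 apex e' -> pivot e = pivot e'.
Proof. by move=> ee; apply: eq_pick => w; rewrite /= ee. Qed.

Lemma pivotP e w : pivot e = Some w -> apex e w != None.
Proof. by rewrite /pivot; case: pickP => // u au [<-]. Qed.

(** The cone contraction of a full simplex, which kills the faces that already contain the cone
    point. *)
Definition fill e : chain :=
  if pivot e is Some w then
    if w \in e.2 then 0 else (sgn F (w |: e.2)%SET w * dir e w) *: << coface w e >>
  else 0.

Lemma hi_bd_fill e w : e.2 \in L -> pivot e = Some w ->
  fglift hi_bd (fill e) + fglift fill (hi_bd e) = << e >>.
Proof.
move=> sL pe; have aw := pivotP pe.
have fillE v : v \in e.2 -> fill (hiface v e) = if w \in (e.2 :\ v)%SET then 0 else
    (sgn F (w |: (e.2 :\ v))%SET w * dir e w) *: << coface w (hiface v e) >>.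
  by move=> vs; rewrite /fill (eq_pivot (apex_hiface sL vs)) pe dir_hiface.
rewrite [X in _ + X]linear_sum /=.
under [X in _ + X]eq_bigr => v vs do rewrite linearZ /= fglift1 fillE //.
rewrite /fill pe; case: ifPn => ws.
  (* If w is a direction of e, only the face without w survives [fill], and its coface is e. *)
  rewrite linear0 add0r (big_setD1 w) //= big1 ?addr0.
    rewrite setD11 finset.setD1K // scalerA coface_hiface //.
    by rewrite mulrACA sgnK dirK mulr1 scale1r.
  by move=> v; rewrite !inE => /andP[nvw _]; rewrite eq_sym nvw ws /= scaler0.
have vw v : v \in e.2 -> v != w by move=> vs; apply: contraNneq ws => <-.
(* Otherwise the face of the coface in direction w is e, and its other faces cancel against the
   cofaces of the faces of e. *)
rewrite linearZ /= fglift1 /hi_bd [(coface w e).2]/= big_setU1 //= scalerDr.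
rewrite hiface_coface // dir_coface // scalerA mulrACA sgnK dirK mulr1 scale1r.
rewrite -addrA -[RHS]addr0; congr (_ + _); rewrite scaler_sumr -big_split big1 //= => v vs.
rewrite in_setD1 (negPf ws) andbF hiface_cofaceC // dir_coface // !scalerA -scalerDl.
set s' := (w |: e.2)%SET.
have vs' : v \in s' by rewrite setU1r.
have ws' : w \in s' by rewrite setU11.
have -> : (w |: (e.2 :\ v) = s' :\ v)%SET.
  by apply/setP => u; rewrite !inE; case: eqVneq => // ->; rewrite eq_sym vw.
have -> : e.2 = (s' :\ w)%SET by rewrite setU1K.
rewrite mulrACA [X in _ + X]mulrACA sgn_swapC // ?vw // mulNr [dir e v * _]mulrC.
by rewrite addNr scale0r.
Qed.

Local Notation cube n m := (fun e => [/\ e.2 \in L, #|e.2| = n & (height e <= m)%N]).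

Lemma fill_on e : e.2 \in L -> on (cube #|e.2|.+1 (height e)) (fill e).
Proof.
move=> sL; rewrite /fill; case pe: pivot => [w|]; last exact: on0.
have aw := pivotP pe; case: ifPn => ws; first exact: on0.
apply: onZ; apply: onU; split; first exact: coface_in.
- by rewrite cardsU1 ws.
- by rewrite height_coface.
Qed.

Lemma lo_bd_on e n : e.2 \in L -> #|e.2| = n.+1 ->
  on (cube n (height e).-1) (lo_bd e).
Proof.
move=> sL cs; apply: on_sum => v vs; apply: onZ; apply: onU; split.
- exact: simplex_face.
- by move: cs; rewrite (cardsD1 v) vs add1n => -[].
- by rewrite -(height_loface sL vs).
Qed.

Definition residue e : chain := << e >> - fglift sal_bd (fill e) - fglift fill (sal_bd e).

(* [fill] is a contraction of the leading terms of [sal_bd], whose graded pieces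
   at a fixed longest vertex are augmented complexes of full simplices. *)
Lemma residue_on e : e.2 \in L -> on (cube #|e.2| (height e).-1) (residue e).
Proof.
move=> sL; rewrite /residue; case pe: (pivot e) => [w|]; last first.
  (* Without a pivot e is the vertex 1, which is its own residue. Its height is 0, and the truncated
     predecessor in the bound admits it. *)
  have a0 v : apex e v = None.
    by apply/eqP; move: pe; rewrite /pivot; case: pickP => // /(_ v) /negbFE.
  have s0 : e.2 = finset.set0.
    by apply/setP => v; rewrite inE; apply/negP => vs; move: (a0 v); rewrite /apex vs.
  rewrite /fill pe linear0 subr0 /sal_bd /kos_bd s0 big_set0 linear0 subr0.
  apply: onU; split; rewrite ?s0 ?cards0 //; first by rewrite -s0.
  have x1 : e.1 = 1%g.
    apply/eqP/negPn/negP => /bead_neq1[v]; have := a0 v.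
    rewrite /apex s0 inE ifT => [->//|]; apply/'forall_implyP => u; by rewrite inE.
  rewrite /height x1 len1 ?s0 eq_card0 // => v; by rewrite !inE.
rewrite -(hi_bd_fill sL pe).
have -> : fglift sal_bd (fill e) = fglift hi_bd (fill e) - fglift lo_bd (fill e).
  by rewrite -fglift_sub; apply: eq_fglift => ?; exact: sal_bdE.
rewrite sal_bdE [fglift fill (_ - _)]linearB /=.
set A := fglift hi_bd _; set B := fglift lo_bd _; set C := fglift fill _; set D := fglift fill _.
have -> : A + C - (A - B) - (C - D) = B + D.
  rewrite !opprB (_ : A + C + (B - A) = B + C).
    by rewrite -addrA [C + _]addrC subrK.
  by rewrite [A + C]addrC -addrA [A + _]addrC subrK addrC.
apply: onD.
  apply: on_fglift (fill_on sL) _ => e' [sL' cs' he'].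
  apply: on_imp (lo_bd_on sL' cs') _ => e'' [? -> h]; split=> //.
  by apply: leq_trans h _; move: he'; rewrite -!subn1 => /leq_sub2r.
case cs: #|e.2| => [|n].
  rewrite /D /lo_bd; move/eqP: cs; rewrite cards_eq0 => /eqP->.
  by rewrite big_set0 linear0; exact: on0.
apply: on_fglift (lo_bd_on sL cs) _ => e' [sL' cs' he'].
by apply: on_imp (fill_on sL') _ => e'' [? -> h]; rewrite cs'; split=> //; exact: leq_trans he'.
Qed.

Definition sal_aug : chain -> F^o := fglift (fun e => (#|e.2| == 0%N)%:R : F^o).

Lemma sal_aug_bd e : sal_aug (sal_bd e) = 0.
Proof.
rewrite /sal_aug linear_sum big1 // => v vs /=; rewrite linearZ /kos_face inE.
by rewrite linearB /= !fglift1 /= subrr scaler0.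
Qed.

Lemma sal_aug_bdl c : sal_aug (fglift sal_bd c) = 0.
Proof.
transitivity (fglift (fun e => sal_aug (sal_bd e)) c); first by rewrite /sal_aug linear_fglift.
by rewrite fgliftE big1 // => e _; rewrite sal_aug_bd scaler0.
Qed.

Lemma height0 e : height e = 0%N -> e.1 = 1%g.
Proof. by case: e => x s /eqP; rewrite addn_eq0 => /andP[/eqP/len_eq0]. Qed.

Lemma height0_simplex e : height e = 0%N -> e = (1%g, finset.set0).
Proof.
move=> h0; have := height0 h0; case: e h0 => x s h0 /= x1; rewrite x1 in h0 *.
congr (_, _); apply/setP => v; rewrite inE; apply/negP => vs.
move/eqP: h0; rewrite addn_eq0 cards_eq0 => /andP[_ /eqP/setP/(_ v)].
by rewrite !inE vs /up bead1.
Qed.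

(** Subtracting the boundary of its filling turns a cycle into its residue, which is lower as long
    as the height is positive. *)
Theorem sal_exact n c : on (fun e => e.2 \in L /\ #|e.2| = n) c ->
    fglift sal_bd c = 0 -> sal_aug c = 0 ->
  exists2 b, on (fun e => e.2 \in L /\ #|e.2| = n.+1) b & fglift sal_bd b = c.
Proof.
(* The sum is merely a convenient upper bound for the heights in the support. *)
move=> onc; have : on (cube n (\sum_(e <- dom c) height e)) c.
  move=> e ec; have [sL cs] := onc e ec; split=> //.
  by rewrite (big_rem e) ?leq_addr //= mem_dom.
move: (\sum_(e <- dom c) height e)%N => m; elim: m c {onc} => [|m IHm] c onc dc augc.
  (* At height 0 only the vertex 1 is left, and its coefficient is the augmentation of c. *)
  exists 0; first exact: on0.
  rewrite linear0 -[c]fgliftU.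
  rewrite (eq_fglift_on (g := fun e => (#|e.2| == 0%N)%:R *: << (1%g, finset.set0) >>) onc).
    transitivity (sal_aug c *: << (1%g, finset.set0) >> : chain); first by rewrite augc scale0r.
    rewrite /sal_aug !fgliftE scaler_suml; apply: eq_bigr => e _; by rewrite scalerA.
  move=> e [_ _]; rewrite leqn0 => /eqP/height0_simplex->.
  by rewrite cards0 eqxx scale1r.
have resE : c - fglift sal_bd (fglift fill c) = fglift residue c.
  rewrite /residue !fglift_sub fgliftU (linear_fglift (fglift sal_bd)) /=.
  by rewrite -[X in _ = _ - X](linear_fglift (fglift fill)) /= dc linear0 subr0.
have onf : on (fun e => e.2 \in L /\ #|e.2| = n.+1) (fglift fill c).
  apply: on_fglift onc _ => e [sL <- _].
  by apply: on_imp (fill_on sL) _ => e' [].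
have [|||b onb db] := IHm (c - fglift sal_bd (fglift fill c)).
- rewrite resE; apply: on_fglift onc _ => e [sL <- he].
  apply: on_imp (residue_on sL) _ => e' [? -> h]; split=> //.
  by apply: leq_trans h _; rewrite -ltnS; case: (height e) he.
- rewrite linearB /= dc sub0r (linear_fglift (fglift sal_bd)) /=.
  rewrite (fglift_eq0_on onf) ?oppr0 // => e [sL _].
  exact: (@kos_bd_bd F V L hL _ rgen [set: V] rgen_comm e sL).
- by rewrite /sal_aug linearB /= -!/(sal_aug _) augc sub0r sal_aug_bdl oppr0.
exists (b + fglift fill c).
  exact: onD.
by rewrite linearD /= db subrK.
Qed.

End Salvetti.

(** * Finite quotients by normal subgroups *)

Section Cosets.
Variables (G : groupType) (N : groupClosed G).
Hypotheses (nN : normal_subgroup N) (finN : finite_set (left_cosets N)).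
Implicit Types x y : G.

Definition lcoset_set x : set G := [set y : G | (x^-1 * y)%g \in N]%classic.

Definition quo : finType := fset_set (left_cosets N).

Lemma lcoset_in x : lcoset_set x \in fset_set (left_cosets N).
Proof. by rewrite in_fset_set // inE; exists x. Qed.

Definition coset_of x : quo := [` lcoset_in x]%fset.

Lemma coset_ofP x y : coset_of x = coset_of y <-> (x^-1 * y)%g \in N.
Proof.
split=> [/(congr1 val)/= e|xy].
  have : lcoset_set y y by rewrite /lcoset_set /= mulVg gpred1.
  by rewrite -e.
apply/val_inj => /=; apply/seteqP; split=> z; rewrite /lcoset_set /= => h.
  have -> : (y^-1 * z = (x^-1 * y)^-1 * (x^-1 * z))%g.
    by rewrite invgM invgK -mulgA mulVKg.
  by apply: gpredM => //; rewrite gpredV.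
have -> : (x^-1 * z = (x^-1 * y) * (y^-1 * z))%g by rewrite -mulgA mulVKg.
exact: gpredM.
Qed.

Lemma coset_of_surj (q : quo) : exists x, coset_of x == q.
Proof.
have := fsvalP q; rewrite in_fset_set // inE => -[x _ e].
by exists x; apply/eqP/val_inj.
Qed.

Definition coset_rep (q : quo) : G := xchoose (coset_of_surj q).

Lemma coset_repK q : coset_of (coset_rep q) = q.
Proof. exact/eqP/(xchooseP (coset_of_surj q)). Qed.

(** By normality the left cosets are also the orbits of left multiplication by N; this quotient
    becomes the coordinate of x in its orbit. *)
Lemma coset_rep_in x : (x * (coset_rep (coset_of x))^-1)%g \in N.
Proof.
have /coset_ofP := coset_repK (coset_of x).
set r := coset_rep _ => /(nN r^-1%g); by rewrite conjgE invgK -!mulgA mulVKg.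
Qed.

Lemma subgroup_valM (g h : subgroup N) : val (g * h)%g = (val g * val h)%g.
Proof. exact: valM. Qed.

Lemma coset_of_mull (h : subgroup N) x : coset_of (val h * x)%g = coset_of x.
Proof.
apply/coset_ofP; rewrite invgM -mulgA.
by apply: (nN x); rewrite gpredV; exact: (valP h).
Qed.

Lemma coset_of_mulr x y z : coset_of x = coset_of y -> coset_of (x * z)%g = coset_of (y * z)%g.
Proof.
move=> /coset_ofP/(nN z) e; apply/coset_ofP.
by move: e; rewrite conjgE invgM !mulgA.
Qed.

Lemma card_quo : #|quo| = group_index N.
Proof. by rewrite /group_index cardfE. Qed.

End Cosets.

(** * Homology of a finite index subgroup from cubes *)

Section GroupBetti.
Variables (R : realType) (F : fieldType) (V : finType) (L : {set {set V}}).
Hypotheses (hL : simplicial_complex L) (hflag : flag L).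
Variable N : groupClosed (raag L).
Hypotheses (nN : normal_subgroup N) (finN : finite_set (left_cosets N)).
Local Notation G := (raag L).
Local Notation Q := (quo N).
Local Notation coset := (coset_of finN).
Local Notation crep := (coset_rep finN).

Definition quo_act v (q : Q) : Q := coset (rgen v (crep q)).

Lemma quo_actE v x : quo_act v (coset x) = coset (rgen v x).
Proof. by apply: coset_of_mulr => //; rewrite coset_repK. Qed.

Lemma quo_act_comm v w q : adjacent L v w ->
  quo_act v (quo_act w q) = quo_act w (quo_act v q).
Proof. by move=> a; rewrite -[q](coset_repK finN) !quo_actE rgen_comm. Qed.

Definition sal_gset : free_gset (subgroup N).
Proof.
pose c (e : G * {set V}) : subgroup N := 
  exist (fun x => x \in N) _ (coset_rep_in nN finN e.1).
pose gact (h : subgroup N) (e : G * {set V}) : G * {set V} := (val h * e.1, e.2)%g.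
pose orb (e : G * {set V}) : Q * {set V} := (coset e.1, e.2).
pose rep (e : Q * {set V}) : G * {set V} := (crep e.1, e.2).
refine (@FreeGset (subgroup N) (G * {set V})%type (Q * {set V})%type gact orb rep c _ _ _ _ _).
- by move=> g h [x s]; congr (_, _); rewrite -[LHS]/(val (g * h) * x)%g subgroup_valM mulgA.
- by move=> g [x s]; congr (_, _); exact: coset_of_mull.
- by move=> [q s]; rewrite /orb /rep /= coset_repK.
- move=> g [x s]; apply: val_inj; rewrite [RHS]subgroup_valM.
  rewrite -[LHS]/(val g * x / crep (coset (val g * x)))%g.
  by rewrite -[val (c _)]/(x / crep (coset x))%g coset_of_mull // mulgA.
- by move=> [x s]; rewrite -[LHS]/(x / crep (coset x) * crep (coset x), s)%g mulgVK.
Defined.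

Lemma sal_bd_equivariant : @equivariant F _ sal_gset sal_gset (@sal_bd F V L).
Proof.
move=> g [x s]; rewrite /lact /sal_bd /kos_bd linear_sum /=; apply: eq_bigr => v _.
rewrite linearZ /= /kos_face !inE; congr (_ *: _).
by rewrite linearB /= !fglift1 /= /rgen mulgA.
Qed.

Lemma sal_resolution : @resolution F _ sal_gset (fun e => e.2 \in L)
  (fun e => #|e.2|) (@sal_bd F V L).
Proof.
split=> [|e sL|e sL|e sL|n c onc dc augc|].
- exact: sal_bd_equivariant.
- by have h := @kos_bd_on F V L hL _ (@rgen V L) [set: V] e sL; exact: h.
- have h := @kos_bd_bd F V L hL _ (@rgen V L) [set: V] (@rgen_comm V L) e sL; exact: h.
- exact: sal_aug_bd.
- exact: sal_exact.
- by exists (1%g, finset.set0); split=> /=; [case: hL|rewrite cards0].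
Qed.

Lemma down_sal e : @down F _ sal_gset sal_gset (@sal_bd F V L) e = kos_bd F quo_act [set: V] e.
Proof.
case: e => q s; rewrite /down /orbm /sal_bd /kos_bd linear_sum /=; apply: eq_bigr => v _.
rewrite linearZ /= /kos_face !inE; congr (_ *: _).
by rewrite linearB /= !fglift1 /= coset_repK.
Qed.

Theorem group_betti_kos (n : nat) : group_betti R F (subgroup N) n%:Z =
  betti R (fun e : Q * {set V} => e.2 \in L) (fun e => #|e.2|%:Z)
    (kos_bd F quo_act [set: V]) n%:Z.
Proof.
have := betti_resolution R n (bar_resolution F (subgroup N)) sal_resolution.
have -> : @down F _ (bar_gset _) (bar_gset _) (@bar_bd F _) = nerve_bd F (G := subgroup N).
  by apply/funext => s; exact: down_bar.
have -> : @down F _ sal_gset sal_gset (@sal_bd F V L) = kos_bd F quo_act [set: V].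
  by apply/funext => e; exact: down_sal.
exact.
Qed.

End GroupBetti.

(** * Betti numbers of finite complexes as matrix ranks *)

Section FiniteBetti.
Variables (R : realType) (F : fieldType).

(** A basis exists in a complement of B. Conversely the matrix of any basis is row free, meets B in
    0 and spans A together with B, which forces m; this determines the infimum in [dim_mod]. *)
Lemma basis_mod_mx n (A B : 'M[F]_n) m : (B <= A)%MS ->
  (exists z : 'I_m -> 'rV[F]_n,
     basis_mod [set v | (v <= A)%MS]%classic [set v | (v <= B)%MS]%classic z) <->
  m = (\rank A - \rank B)%N.
Proof.
move=> BA; have rk : (\rank (A :\: B)%MS = \rank A - \rank B)%N.
  by rewrite -(mxrank_cap_compl A B) (capmx_idPr BA) addKn.
have rowsum k (M : 'M[F]_(k, n)) (a : 'I_k -> F) :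
    \sum_j a j *: row j M = (\row_j a j) *m M.
  by rewrite mulmx_sum_row; apply: eq_bigr => j _; rewrite mxE.
split=> [[z [zA genz freez]]|->]; last first.
  rewrite -rk; exists (fun j => row j (row_base (A :\: B)%MS)); split=> [j|c /= cA|a /=].
  - rewrite /=; apply: submx_trans (row_sub _ _) _; rewrite eq_row_base; exact: diffmxSl.
  - have : (c <= A :\: B + A :&: B)%MS by rewrite addsmx_diff_cap_eq.
    case/sub_addsmxP => -[u1 u2] /= ->.
    have : (u1 *m (A :\: B) <= row_base (A :\: B)%MS)%MS by rewrite eq_row_base submxMl.
    case/submxP => a ->; exists (fun j => a 0 j); rewrite rowsum.
    have -> : \row_j a 0 j = a by apply/rowP => j; rewrite mxE.
    by rewrite addrC addKr; apply: submx_trans (submxMl _ _) (capmxSr _ _).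
  - rewrite rowsum => sB; have : (\row_j a j *m row_base (A :\: B)%MS <= (A :\: B) :&: B)%MS.
      by rewrite sub_capmx sB -(eq_row_base (A :\: B)%MS) submxMl.
    rewrite capmx_diff submx0 -(mul0mx _ (row_base (A :\: B)%MS)) => /eqP.
    by move/(row_free_inj (row_base_free _)) => /rowP a0 j; have := a0 j; rewrite !mxE.
pose M := \matrix_j z j; have zE j : z j = row j M by rewrite rowK.
have Mz a : \sum_j a j *: z j = (\row_j a j) *m M.
  by rewrite -rowsum; apply: eq_bigr => j _; rewrite zE.
have Minj (v : 'rV_m) : (v *m M <= B)%MS -> v = 0.
  move=> vB; apply/rowP => j; rewrite mxE.
  apply: (freez (fun j => v 0 j)) => /=; rewrite Mz.
  by rewrite (_ : \row_j v 0 j = v) //; apply/rowP => i; rewrite mxE.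
have freeM : row_free M.
  by rewrite -kermx_eq0; apply/rowV0P => v /sub_kermxP vM; apply: Minj; rewrite vM sub0mx.
have capMB : (M :&: B = 0)%MS.
  apply/eqP; rewrite -submx0; apply/rV_subP => v; rewrite sub_capmx => /andP[/submxP[a ->]].
  by move/Minj->; rewrite mul0mx sub0mx.
have sumMB : (M + B :=: A)%MS.
  apply/eqmxP; rewrite addsmx_sub BA andbT; apply/andP; split.
    by apply/row_subP => j; rewrite -zE; exact: zA.
  apply/rV_subP => c /genz[a]; rewrite /= Mz => caB.
  rewrite -[c](subrK ((\row_j a j) *m M)) addmx_sub //.
    exact: submx_trans caB (addsmxSr _ _).
  exact: submx_trans (submxMl _ _) (addsmxSl _ _).
have := mxrank_disjoint_sum capMB; rewrite sumMB (eqP freeM) => ->.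
by rewrite addnK.
Qed.

Lemma dim_mod_mx n (A B : 'M[F]_n) : (B <= A)%MS ->
  dim_mod R [set v : 'rV[F]_n | (v <= A)%MS]%classic [set v | (v <= B)%MS]%classic =
  ((\rank A - \rank B)%N%:R)%:E.
Proof.
move=> BA; rewrite /dim_mod.
rewrite [X in ereal_inf (_ @` X)](_ : _ = [set (\rank A - \rank B)%N]%classic).
  by rewrite image_set1 ereal_inf1.
by apply/seteqP; split=> m /= /(basis_mod_mx _ BA).
Qed.

Section Matrices.
Variable X : finType.
Local Notation chain := {freeg X / F}.

Definition vec (c : chain) : 'rV[F]_#|X| := \row_j coeff (enum_val j) c.
Definition unvec (v : 'rV[F]_#|X|) : chain := \sum_j v 0 j *: << enum_val j >>.
Definition fmx (f : X -> chain) : 'M[F]_#|X| := \matrix_(i, j) coeff (enum_val j) (f (enum_val i)).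
Definition cellmx (A : pred X) : 'M[F]_#|X| :=
  \matrix_(i, j) ((i == j) && A (enum_val i))%:R.

Fact vec_is_linear : linear vec.
Proof. by move=> a b c; apply/rowP => j; rewrite !mxE coeffD coeffZ. Qed.
HB.instance Definition _ := GRing.isLinear.Build F _ _ *:%R vec vec_is_linear.

Fact unvec_is_linear : linear unvec.
Proof.
move=> a b c; rewrite /unvec scaler_sumr -big_split; apply: eq_bigr => j _ /=.
by rewrite !mxE scalerDl scalerA.
Qed.
HB.instance Definition _ := GRing.isLinear.Build F _ _ *:%R unvec unvec_is_linear.

Lemma vecU x : vec << x >> = delta_mx 0 (enum_rank x).
Proof.
apply/rowP => j; rewrite !mxE coeffU mul1r eqxx /=.
by rewrite -(inj_eq enum_val_inj) enum_rankK eq_sym.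
Qed.

Lemma unvecK : cancel unvec vec.
Proof.
move=> v; rewrite /unvec linear_sum [RHS]row_sum_delta; apply: eq_bigr => j _.
by rewrite linearZ /= vecU enum_valK.
Qed.

Lemma vecK : cancel vec unvec.
Proof.
move=> c; have inj : injective vec.
  move=> b b' /rowP e; apply/eqP/freeg_eqP => x.
  by have := e (enum_rank x); rewrite !mxE enum_rankK.
by apply: inj; rewrite unvecK.
Qed.

Lemma vec_fglift f c : vec (fglift f c) = vec c *m fmx f.
Proof.
have row_fmx x : row (enum_rank x) (fmx f) = vec (f x).
  by apply/rowP => j; rewrite !mxE enum_rankK.
rewrite -[c in RHS]fgliftU !fgliftE !linear_sum mulmx_suml; apply: eq_bigr => x _.
by rewrite !linearZ /= vecU -scalemxAl -rowE row_fmx.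
Qed.

Lemma vec_cellmx (A : pred X) c : on A c <-> vec c *m cellmx A = vec c.
Proof.
have E j : (vec c *m cellmx A) 0 j = if A (enum_val j) then vec c 0 j else 0.
  rewrite mxE (bigD1 j) //= big1 ?addr0 => [|i ne].
    by rewrite [cellmx _ _ _]mxE eqxx; case: ifP; rewrite ?mulr1 ?mulr0.
  by rewrite [cellmx _ _ _]mxE (negPf ne) mulr0.
split=> [onA|e x nz].
  apply/rowP => j; rewrite E; case: ifP => // /negbT nA; rewrite mxE.
  by apply/esym/eqP/negPn/negP => /onA; apply/negP.
have := E (enum_rank x); rewrite e mxE enum_rankK; case: ifP => // _ /eqP.
by rewrite (negPf nz).
Qed.

Lemma cellmx_idem A : cellmx A *m cellmx A = cellmx A.
Proof.
apply/row_matrixP => i; rewrite row_mul.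
have -> : row i (cellmx A) = vec (if A (enum_val i) then << enum_val i >> else 0).
  apply/rowP => j; rewrite !mxE; case: ifP => Ai; last by rewrite andbF coeff0.
  by rewrite coeffU mul1r andbT (inj_eq enum_val_inj).
by apply/vec_cellmx; case: ifP => Ai; [exact: onU|exact: on0].
Qed.

Lemma sub_cellmx (A : pred X) c : on A c <-> (vec c <= cellmx A)%MS.
Proof.
split=> [/vec_cellmx<-|/submxP[D e]]; first exact: submxMl.
by apply/vec_cellmx; rewrite e -mulmxA cellmx_idem.
Qed.

Definition degmx (P : pred X) (deg : X -> int) i := cellmx (fun x => P x && (deg x == i)).

(** All degrees share the matrix space indexed by X; the projections [degmx] cut the differential
    down to the cells of P in one degree. *)
Theorem betti_rank (P : pred X) (deg : X -> int) (bd : X -> chain) i :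
    (forall x, P x -> on (fun y => P y /\ deg y + 1 = deg x) (bd x)) ->
    (forall x, P x -> fglift bd (bd x) = 0) ->
  betti R P deg bd i = ((\rank (degmx P deg i) - \rank (degmx P deg i *m fmx bd)
                         - \rank (degmx P deg (i + 1)%R *m fmx bd))%N%:R)%:E.
Proof.
move=> onbd dd; set E := degmx P deg; set D := fmx bd.
have chainsE j c : chains P deg j c <-> (vec c <= E j)%MS.
  rewrite -sub_cellmx; split=> h x /h; first by case=> -> ->; rewrite eqxx.
  by case/andP => -> /eqP.
have cyclesE c : cycles P deg bd i c <-> (vec c <= E i :&: kermx D)%MS.
  rewrite sub_capmx; split=> [[/chainsE-> /= dc]|/andP[/chainsE ? /sub_kermxP e]].
    by apply/sub_kermxP; rewrite -vec_fglift dc linear0.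
  by split=> //=; rewrite -[LHS]vecK vec_fglift e linear0.
have boundariesE c : boundaries P deg bd i c <-> (vec c <= E (i + 1)%R *m D)%MS.
  split=> [[b /chainsE/submxP[u eu] <-]|/submxP[u eu]].
    by rewrite vec_fglift eu -mulmxA submxMl.
  exists (unvec (u *m E (i + 1))); first by apply/chainsE; rewrite unvecK submxMl.
  by rewrite -[LHS]vecK vec_fglift unvecK -mulmxA -eu vecK.
have BZ : (E (i + 1)%R *m D <= E i :&: kermx D)%MS.
  apply/rV_subP => v; rewrite -[v]unvecK => /boundariesE [c cc <-].
  apply/cyclesE; split=> /=; last first.
    rewrite linear_fglift /=; apply: fglift_eq0_on cc _ => x [Px _]; exact: dd.
  apply: on_fglift cc _ => x [Px degx]; apply: on_imp (onbd x Px) _ => y [Py].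
  by rewrite degx => /addIr.
(* Rank and nullity of the differential restricted to degree i. *)
rewrite -(mxrank_mul_ker (E i) D) addKn -dim_mod_mx //.
apply: (@dim_mod_iso _ _ _ _ _ _ _ _ vec unvec).
- exact: subspace_cycles.
- exact: subspace_boundaries.
- by split=> [|a b c /= ? ?] /=; rewrite ?sub0mx // addmx_sub // scalemx_sub.
- by split=> [|a b c /= ? ?] /=; rewrite ?sub0mx // addmx_sub // scalemx_sub.
- by move=> z /cyclesE.
- by move=> z /boundariesE.
- by move=> v /= h; apply/cyclesE; rewrite unvecK.
- by move=> v /= h; apply/boundariesE; rewrite unvecK.
- by move=> z _; rewrite /= vecK subrr; case: (subspace_boundaries P deg bd i).
- by move=> v _; rewrite /= unvecK subrr sub0mx.
Qed.

End Matrices.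
End FiniteBetti.

(** * Ranks of projections, block matrices and invariant matrices *)

Section MatrixRanks.
Variable F : fieldType.

Lemma fmx_comp (X : finType) (f g : X -> {freeg X / F}) :
  fmx f *m fmx g = fmx (fun x => fglift g (f x)).
Proof.
have rowE (h : X -> {freeg X / F}) i : row i (fmx h) = vec (h (enum_val i)).
  by apply/rowP => j; rewrite !mxE.
by apply/row_matrixP => i; rewrite row_mul !rowE vec_fglift.
Qed.

Lemma cellmxE (X : finType) (A : pred X) :
  cellmx F A = fmx (fun x => if A x then << x >> else 0).
Proof.
apply/matrixP => i j; rewrite !mxE; case: ifP => _; last by rewrite andbF coeff0.
by rewrite coeffU mul1r andbT (inj_eq enum_val_inj).
Qed.

Lemma rank_cellmx (X : finType) (A : pred X) : \rank (cellmx F A) = #|A|.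
Proof.
(* The inclusion of the coordinates in A: the projection factors through it, and it has a right
   inverse. *)
pose S : 'M[F]_(#|A|, #|X|) := \matrix_(i, j) (enum_val j == enum_val i :> X)%:R.
have SS : S *m S^T = 1%:M.
  apply/matrixP => i k; rewrite !mxE (bigD1 (enum_rank (enum_val i))) //= big1 => [|j ne].
    by rewrite !mxE enum_rankK eqxx mul1r addr0 (inj_eq enum_val_inj).
  have /negPf nji : enum_val j != enum_val i by apply: contraNneq ne => <-; rewrite enum_valK.
  by rewrite !mxE nji mul0r.
have ES : S^T *m S = cellmx F A.
  apply/matrixP => j k; rewrite !mxE; have [Aj|nAj] := boolP (A (enum_val j)).
    have Aj' : enum_val j \in A by [].
    rewrite (bigD1 (enum_rank_in Aj' (enum_val j))) //= big1 => [|i ne].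
      by rewrite !mxE enum_rankK_in // eqxx mul1r addr0 andbT eq_sym (inj_eq enum_val_inj).
    have /negPf nji : enum_val j != enum_val i :> X.
      by apply: contraNneq ne => e; rewrite -(enum_valK_in Aj' i) -e.
    by rewrite !mxE nji mul0r.
  rewrite andbF big1 // => i _; rewrite !mxE.
  have /negPf-> : enum_val j != enum_val i :> X.
    by apply: contraNneq nAj => ->; exact: (enum_valP i).
  by rewrite mul0r.
apply/eqP; rewrite eqn_leq -ES; apply/andP; split.
  exact: leq_trans (mxrankM_maxr _ _) (rank_leq_row _).
have e : S *m (S^T *m S) *m S^T = 1%:M by rewrite mulmxA SS mul1mx SS.
rewrite -{1}(mxrank1 F #|A|) -e.
exact: leq_trans (mxrankM_maxl _ _) (mxrankM_maxr _ _).
Qed.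

Section Blocks.
Variables (Q T : finType).

(** The Kronecker product of the identity of F[Q] with A. *)
Definition blockmx (A : 'M[F]_#|T|) : 'M[F]_#|{: Q * T}| :=
  \matrix_(i, j) (((enum_val i).1 == (enum_val j).1)%:R *
                  A (enum_rank (enum_val i).2) (enum_rank (enum_val j).2)).

Lemma blockmxM A B : blockmx (A *m B) = blockmx A *m blockmx B.
Proof.
apply/matrixP => i j; rewrite !mxE (reindex enum_rank) /=; last first.
  by exists enum_val => ? _; rewrite ?enum_rankK ?enum_valK.
rewrite [RHS](reindex enum_rank) /=; last first.
  by exists enum_val => ? _; rewrite ?enum_rankK ?enum_valK.
under [RHS]eq_bigr => x _ do rewrite !mxE enum_rankK.
rewrite -(pair_bigA _ (fun q t =>
  ((enum_val i).1 == q)%:R * A (enum_rank (enum_val i).2) (enum_rank t) *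
  ((q == (enum_val j).1)%:R * B (enum_rank t) (enum_rank (enum_val j).2)))) /=.
rewrite (bigD1 (enum_val i).1) //= [X in _ + X]big1 ?addr0 => [|q ne].
  by rewrite eqxx mulr_sumr; apply: eq_bigr => t _; rewrite mul1r mulrCA.
by apply: big1 => t _; rewrite eq_sym (negPf ne) !mul0r.
Qed.

Lemma blockmx1 : blockmx 1%:M = 1%:M.
Proof.
apply/matrixP => i j; rewrite !mxE -natrM mulnb (inj_eq enum_rank_inj).
by rewrite -(inj_eq enum_val_inj) [in RHS](surjective_pairing (enum_val i)) -pair_eqE.
Qed.

Lemma blockmx_unit A : A \in unitmx -> blockmx A \in unitmx.
Proof.
move=> uA; have := mulmxV uA => /(congr1 blockmx); rewrite blockmxM blockmx1.
by case/mulmx1_unit.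
Qed.

(** Blocks are multiplicative and preserve invertibility, so Gaussian elimination of A reduces this
    to counting the cells of a coordinate projection. *)
Lemma rank_blockmx A : \rank (blockmx A) = (#|Q| * \rank A)%N.
Proof.
rewrite -{1}(mulmx_ebase A) !blockmxM mxrankMfree; last first.
  by rewrite row_free_unit; apply: blockmx_unit; exact: row_ebase_unit.
rewrite eqmxMfull; last first.
  by rewrite row_full_unit; apply: blockmx_unit; exact: col_ebase_unit.
have -> : blockmx (pid_mx (\rank A)) =
    cellmx F (fun x : Q * T => (enum_rank x.2 < \rank A)%N).
  apply/matrixP => i j; rewrite !mxE -natrM mulnb; congr (_%:R : F); congr nat_of_bool.
  rewrite andbA [nat_of_ord _ == _](inj_eq val_inj) (inj_eq enum_rank_inj).
  by rewrite -(inj_eq enum_val_inj) [in RHS](surjective_pairing (enum_val i)) -pair_eqE.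
rewrite rank_cellmx; move: (\rank A) (rank_leq_row A) => r ler.
have -> : (#|Q| * r = #|Q| * #|[pred t : T | (enum_rank t < r)%N]|)%N.
  pose w (i : 'I_r) : T := enum_val (widen_ord ler i).
  have w_inj : injective w by move=> i j /enum_val_inj/(congr1 val)/= /val_inj.
  rewrite -[in LHS](card_ord r) -(card_imset _ w_inj); congr (_ * _)%N.
  apply: eq_card => t; apply/imsetP/idP => [[i _ ->]|lt]; first by rewrite inE enum_valK /=.
  by exists (Ordinal lt) => //; apply: enum_rank_inj; rewrite enum_valK; exact: val_inj.
by rewrite -cardX; apply: eq_card => -[q t]; rewrite !inE.
Qed.

End Blocks.

(* If rank K columns of K are independent, no two of them lie in the same orbit,
   so their first m translates under f are distinct. *)
Lemma rank_invariant (X : finType) (f : X -> X) m k (K : 'M[F]_(k, #|X|)) :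
    injective f -> (forall x j, (0 < j < m)%N -> iter j f x != x) ->
    (forall i x, K i (enum_rank (f x)) = K i (enum_rank x)) ->
  (\rank K * m <= #|X|)%N.
Proof.
move=> inj_f nofix invK.
pose g := maxrankfun K^T; pose x i : X := enum_val (g i).
have invI i y j : K i (enum_rank (iter j f y)) = K i (enum_rank y).
  by elim: j => //= j <-.
have x_inj i i' j : x i = iter j f (x i') -> i = i'.
  move=> e; have : row i (rowsub g K^T) = row i' (rowsub g K^T).
    apply/rowP => l; rewrite !mxE -[g i]enum_valK -[g i']enum_valK.
    by rewrite -/(x i) -/(x i') e invI.
  rewrite !rowE => /(row_free_inj (maxrowsub_free _)) /rowP/(_ i).
  by rewrite !mxE !eqxx /=; case: (i =P i') => // _ /eqP; rewrite oner_eq0.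
pose h (p : 'I_(\rank K^T) * 'I_m) := iter p.2 f (x p.1).
have iter_inj j y z : iter j f y = iter j f z -> y = z.
  by elim: j => //= j IHj /inj_f.
have h_inj : injective h.
  suff wl i (j : 'I_m) i' (j' : 'I_m) : (j <= j')%N -> h (i, j) = h (i', j') -> (i, j) = (i', j').
    move=> [i j] [i' j']; case: (leqP j j') => [|/ltnW] le e; first exact: wl.
    by apply/esym/wl.
  rewrite /h /= => le; rewrite -(subnKC le) iterD => /iter_inj e.
  have ii := x_inj _ _ _ e; subst i'; congr (_, _).
  apply/val_inj/eqP; rewrite eqn_leq le /= leqNgt -subn_gt0; apply/negP => pos.
  have := nofix (x i) (j' - j)%N; rewrite pos (leq_ltn_trans (leq_subr _ _)) //.
  by rewrite -e eqxx => /(_ isT).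
rewrite -mxrank_tr -[m in (_ * m)%N]card_ord -[\rank _]card_ord -card_prod.
exact: leq_card h_inj.
Qed.

End MatrixRanks.

(** * Replacing g_v - 1 by 1 in the differential *)

Section RankComparison.
Variables (F : fieldType) (V : finType) (L : {set {set V}}).
Hypothesis hL : simplicial_complex L.
Variables (Q : finType) (act : V -> Q -> Q).
Hypothesis act_comm : forall v w x, adjacent L v w -> act v (act w x) = act w (act v x).
Local Notation cell := (Q * {set V})%type.
Local Notation chain := {freeg cell / F}.
Implicit Types (U : {set V}) (e : cell).

Definition kos_cmp v e : chain :=
  if v \in e.2 then << (act v e.1, e.2) >> - << e >> else << e >>.

Lemma kos_cmp_on v e : on (fun e' : cell => e'.2 = e.2) (kos_cmp v e).
Proof. by rewrite /kos_cmp; case: ifP => _; [apply: onB|]; exact: onU. Qed.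

(* Turning the coefficient [1] of the faces in direction v into [v - 1]
   commutes with applying [v - 1] to the cubes in direction v. *)
Lemma kos_cmp_bd U v e : v \notin U -> e.2 \in L ->
  fglift (kos_cmp v) (kos_bd F act (v |: U)%SET e) = fglift (kos_bd F act U) (kos_cmp v e).
Proof.
have swap (M : zmodType) (a b c d : M) : a - b - (c - d) = a - c - (b - d).
  by rewrite !opprB addrACA [RHS]addrACA [- b - c]addrC.
case: e => q s vU /= sL; rewrite /kos_bd -/(kos_bd _ _ _) linear_sum /=.
rewrite [kos_cmp v (q, s)]/kos_cmp /=; case: ifP => vs; last first.
  rewrite fglift1 /kos_bd; apply: eq_bigr => w ws; rewrite linearZ /=; congr (_ *: _).
  have nwv : w != v by apply: contraFneq vs => <-.
  rewrite /kos_face !inE (negPf nwv) /=.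
  have out : v \in (s :\ w)%SET = false by rewrite inE vs andbF.
  by case: ifP => _; rewrite ?linearB /= !fglift1 /kos_cmp /= out.
rewrite linearB /= !fglift1 /kos_bd -sumrB; apply: eq_bigr => w ws.
rewrite linearZ -scalerBr; congr (_ *: _); rewrite /kos_face !inE /=.
have [->|nwv] /= := eqVneq w v.
  by rewrite (negPf vU) linearB /= !fglift1 /kos_cmp /= !inE eqxx.
have into : v \in (s :\ w)%SET by rewrite !inE eq_sym nwv vs.
case: ifP => wU; rewrite ?linearB /= !fglift1 /kos_cmp /= into //.
have a : adjacent L v w by apply: (simplex_adjacent hL sL) => //; rewrite eq_sym.
by rewrite (act_comm _ a) -opprD; exact: swap.
Qed.

Definition kos_deg e : int := #|e.2|%:Z.
Definition kos_pred : pred cell := fun e => e.2 \in L.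
Definition kos_rank U i := \rank (degmx F kos_pred kos_deg i *m fmx (kos_bd F act U)).

(** Vectors are rows, so products read from left to right. The projection to degree i passes through
    because [kos_cmp] preserves the simplex of a cell. *)
Lemma kos_cmp_mx U v i : v \notin U ->
  degmx F kos_pred kos_deg i *m fmx (kos_bd F act (v |: U)%SET) *m fmx (kos_cmp v) =
  fmx (kos_cmp v) *m (degmx F kos_pred kos_deg i *m fmx (kos_bd F act U)).
Proof.
move=> vU; rewrite /degmx cellmxE !fmx_comp; congr fmx; apply/funext => e.
pose A (x : cell) := kos_pred x && (kos_deg x == i).
have A_eq e' : e'.2 = e.2 -> A e' = A e by rewrite /A /kos_pred /kos_deg => ->.
rewrite -/(A e); case Ae: (A e).
  rewrite fglift1 kos_cmp_bd //; last by case/andP: Ae.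
  refine (eq_fglift_on (@kos_cmp_on v e) _) => e' ee'.
  by rewrite -/(A e') A_eq // Ae fglift1.
rewrite !linear0; symmetry; refine (fglift_eq0_on (@kos_cmp_on v e) _) => e' ee'.
by rewrite -/(A e') A_eq // Ae linear0.
Qed.

Hypothesis act_inj : forall v, injective (act v).
Variable m : nat.
Hypothesis act_free : forall v q j, (0 < j < m)%N -> iter j (act v) q != q.

(** A kernel vector is constant along the orbits of [act v], which have at least m points;
    [rank_invariant] then bounds the nullity. *)
Lemma kos_cmp_rank v : (m * (#|{: cell}| - \rank (fmx (kos_cmp v))) <= #|{: cell}|)%N.
Proof.
rewrite -mxrank_ker mulnC.
pose f e : cell := (act v e.1, e.2).
have iterf j e : iter j f e = (iter j (act v) e.1, e.2) by elim: j => [|j /= ->] //; case: e.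
apply: (@rank_invariant F _ f) => [[q s] [q' s'] [/act_inj-> ->] //|e j jm|i e].
  by rewrite iterf; case: e => q s; apply: contraNneq (act_free v q jm) => -[->].
pose c := unvec (row i (kermx (fmx (kos_cmp v)))).
have coeffE x : coeff x c = kermx (fmx (kos_cmp v)) i (enum_rank x).
  have := congr1 (fun u : 'rV_ _ => u 0 (enum_rank x)) (unvecK (row i (kermx (fmx (kos_cmp v))))).
  by rewrite /= !mxE enum_rankK.
have c0 : fglift (kos_cmp v) c = 0.
  apply: (can_inj (@vecK F cell)); rewrite vec_fglift unvecK linear0 -row_mul mulmx_ker.
  by rewrite linear0.
have co (x : cell) (k : cell -> F^o) : (forall y, coeff x (kos_cmp v y) = k y) -> fglift k c = 0.
  move=> xk; rewrite -(coeff0 F x) -c0 !fgliftE raddf_sum; apply: eq_bigr => y _.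
  by rewrite /= coeffZ xk.
(* On simplices without v the map is the identity, so the coefficients vanish there. *)
rewrite -!coeffE; case: e => q s; rewrite /f /=; have [vs|vs] := boolP (v \in s); last first.
  have c_out q' : coeff (q', s) c = 0.
    apply: (co (q', s)) => -[q'' s']; rewrite /kos_cmp /=; case: ifP => vs'.
      have ne : s' != s by apply: contraNneq vs => <-.
      by rewrite coeffB !coeffU !xpair_eqE (negPf ne) !andbF mulr0 subr0.
    by rewrite coeffU mul1r.
  by rewrite !c_out.
(* Since [act v] is injective, the coefficient of the image at [(act v q, s)] is the one of c at
   [(q, s)] minus the one at [(act v q, s)]. *)
apply/esym/eqP; rewrite -subr_eq0; apply/eqP.
have := co (act v q, s) (fun y => (y == (q, s))%:R - (y == (act v q, s))%:R).
rewrite fglift_sub; apply => -[q' s']; rewrite /kos_cmp /=; case: ifP => vs'.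
  by rewrite coeffB !coeffU !mul1r !xpair_eqE (inj_eq (act_inj (v := v))).
have ne : s' != s by apply: contraFneq vs' => ->.
by rewrite coeffU !xpair_eqE (negPf ne) !andbF mulr0 subr0.
Qed.

(** With A P = P B, Sylvester's inequality for one product and monotonicity for the other compare
    the ranks in both directions. The factor m clears the denominator of the corank. *)
Lemma kos_rank_step U v i : v \notin U ->
  (m * kos_rank (v |: U)%SET i <= m * kos_rank U i + #|{: cell}|)%N /\
  (m * kos_rank U i <= m * kos_rank (v |: U)%SET i + #|{: cell}|)%N.
Proof.
move=> vU; have cmp := kos_cmp_mx i vU; have corank := kos_cmp_rank v.
set A := degmx _ _ _ i *m fmx (kos_bd F act (v |: U)%SET) in cmp.
set B := degmx _ _ _ i *m fmx (kos_bd F act U) in cmp.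
set P := fmx (kos_cmp v) in cmp corank; set n := #|{: cell}| in corank *.
have half a b : (a + \rank P - n <= b)%N -> (m * a <= m * b + n)%N.
  rewrite leq_subLR => ab; apply: leq_trans (_ : m * b + m * (n - \rank P) <= _)%N.
    rewrite -mulnDr leq_mul2l; apply/orP; right.
    rewrite addnBA ?rank_leq_row // leq_subRL ?(leq_trans (rank_leq_row _)) ?leq_addl //.
    by rewrite addnC [(b + n)%N]addnC.
  by rewrite leq_add2l.
split; apply: half.
  apply: leq_trans (mxrank_mul_min A P) _; rewrite cmp; exact: mxrankM_maxr.
rewrite addnC; apply: leq_trans (mxrank_mul_min P B) _; rewrite -cmp; exact: mxrankM_maxl.
Qed.

Lemma kos_rank_bound U i :
  (m * kos_rank U i <= m * kos_rank finset.set0 i + #|U| * #|{: cell}|)%N /\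
  (m * kos_rank finset.set0 i <= m * kos_rank U i + #|U| * #|{: cell}|)%N.
Proof.
have [k] := ubnP #|U|; elim: k U => // k IHk U ltk.
have [->|[v vU]] := set_0Vmem U; first by rewrite cards0 !mul0n !addn0.
have vU' : v \notin (U :\ v)%SET by rewrite setD11.
have := kos_rank_step i vU'; rewrite finset.setD1K // => -[s1 s2].
have := cardsD1 v U; rewrite vU add1n => cU; rewrite cU in ltk *.
have [h1 h2] := IHk _ ltk; rewrite mulSn; split.
  by apply: leq_trans s1 _; rewrite addnCA [X in (X <= _)%N]addnC leq_add2l.
by apply: leq_trans h2 _; rewrite addnA leq_add2r.
Qed.

End RankComparison.

(** * Growth along the chain *)

Section Growth.
Variables (R : realType) (F : fieldType) (V : finType) (L : {set {set V}}).

(** The hypothesis says that b / q is eventually within C / m of c, for every m, so the sequence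
    converges. *)
Lemma limn_esup_ratio (b q : nat -> nat) (c C : nat) :
    (forall k, (0 < q k)%N) ->
    (forall m, (0 < m)%N -> exists K, forall k, (K <= k)%N ->
      (m * b k <= m * (q k * c) + C * q k)%N /\ (m * (q k * c) <= m * b k + C * q k)%N) ->
  limn_esup (fun k => ((b k)%:R%:E * ((q k)%:R^-1)%:E)%E) = (c%:R : R)%:E.
Proof.
move=> q0 bq; apply: (cvg_limn_einf_sup _).2; apply: cvg_EFin; first exact: nearW.
apply/cvgrPdist_le => e e0.
have [m m1 Cm] : exists2 m, (0 < m)%N & C%:R <= e * m%:R.
  exists (Num.truncn (C%:R / e)).+1 => //.
  by rewrite mulrC -ler_pdivrMr //; apply/ltW/truncnS_gt.
have [K bqK] := bq m m1; exists K => // k /= /bqK[le1 le2].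
have qk : 0 < (q k)%:R :> R by rewrite ltr0n.
have m0 : 0 < m%:R :> R by rewrite ltr0n.
rewrite -[X in X <= _](mulfK (lt0r_neq0 qk)) ler_pdivrMr //.
rewrite -{2}[(q k)%:R]gtr0_norm // -normrM mulrBl.
rewrite divfK ?lt0r_neq0 // -(ler_pM2l m0) -{1}[m%:R]gtr0_norm // -normrM mulrBr.
have le3 : C%:R * (q k)%:R <= m%:R * (e * (q k)%:R).
  by rewrite mulrA [m%:R * e]mulrC ler_pM2r.
move: le1 le2; rewrite -!(ler_nat R) !natrD !natrM => le1 le2.
rewrite [c%:R * _]mulrC ler_norml; apply/andP; split.
  rewrite lerBrDl lerBlDr; apply: le_trans le1 _; by rewrite lerD2l.
by rewrite lerBlDl; apply: le_trans le2 _; rewrite lerD2l.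
Qed.

Hypothesis hL : simplicial_complex L.
Local Notation sdeg := (fun s : {set V} => #|s|%:Z).
Local Notation srank i :=
  (\rank (degmx F (fun s : {set V} => s \in L) sdeg i *m fmx (@simplex_bd F V))).
Local Notation ncell i := (\rank (degmx F (fun s : {set V} => s \in L) sdeg i)).

(** When U is empty no coefficient moves the component in Q. *)
Lemma blockmx_kos (Q : finType) (act : V -> Q -> Q) :
  fmx (kos_bd F act finset.set0) = blockmx Q (fmx (@simplex_bd F V)).
Proof.
apply/matrixP => i j; rewrite !mxE !enum_rankK; case: (enum_val i) (enum_val j) => q s [q' s'] /=.
rewrite /kos_bd /simplex_bd !raddf_sum mulr_sumr; apply: eq_bigr => v _ /=.
by rewrite /kos_face inE !coeffZ !coeffU !mul1r xpair_eqE mulrCA -natrM mulnb.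
Qed.

Lemma blockmx_deg (Q : finType) i :
  degmx F (kos_pred L (Q := Q)) (@kos_deg V Q) i = blockmx Q (degmx F (fun s => s \in L) sdeg i).
Proof.
apply/matrixP => j k; rewrite !mxE -natrM mulnb; congr (_%:R : F); congr nat_of_bool.
rewrite enum_rankK [RHS]andbA (inj_eq enum_rank_inj) -xpair_eqE -!surjective_pairing.
by rewrite (inj_eq enum_val_inj).
Qed.

Lemma simplex_bd_on s : s \in L ->
  on (fun t : {set V} => t \in L /\ #|t|.+1 = #|s|) (simplex_bd F s).
Proof.
move=> sL; apply: on_sum => v vs; apply: onZ; apply: onU; split; first exact: simplex_face.
by rewrite (cardsD1 v s) vs.
Qed.

(** The simplicial complex is the case of a one-point set, so [kos_bd_bd] applies. *)
Lemma simplex_bd_bd s : s \in L -> fglift (@simplex_bd F V) (simplex_bd F s) = 0.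
Proof.
move=> sL; pose kb := kos_bd F (fun (_ : V) (u : unit) => u) finset.set0.
pose proj := fglift (fun e : unit * {set V} => << e.2 >> : {freeg {set V} / F}).
have projE e : proj (kb e) = simplex_bd F e.2.
  rewrite /proj linear_sum; apply: eq_bigr => v _; rewrite linearZ /=.
  by rewrite /kos_face inE fglift1.
rewrite -(projE (tt, s)) /proj linear_fglift /=.
transitivity (proj (fglift kb (kb (tt, s)))).
  rewrite /proj [RHS]linear_fglift /=; apply: eq_fglift => e.
  by rewrite fglift1 -/(proj _) projE.
by rewrite /kb (kos_bd_bd _ hL) ?/proj ?linear0.
Qed.

Lemma reduced_betti_rank (i : nat) : reduced_betti R F L (i%:Z - 1) =
  ((ncell i%:Z - srank i%:Z - srank (i.+1)%:Z)%N%:R)%:E.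
Proof.
rewrite /reduced_betti betti_rank; first last.
- exact: simplex_bd_bd.
- move=> s sL; apply: on_imp (simplex_bd_on sL) _ => t [tL <-].
  by split=> //; rewrite -addn1 PoszD addrAC.
have degE (j : int) : degmx F (mem L) (fun s : {set V} => #|s|%:Z - 1) (j - 1) =
    degmx F (fun s : {set V} => s \in L) sdeg j.
  apply/matrixP => k l; rewrite !mxE; congr (_ && (_ && _))%:R.
  by rewrite (inj_eq (addIr _)).
have -> : i%:Z - 1 + 1 = (i.+1)%:Z - 1 by rewrite addrAC -PoszD addn1.
by rewrite !degE.
Qed.

Lemma kos_betti_rank (Q : finType) (act : V -> Q -> Q) (i : nat) :
    (forall v w x, adjacent L v w -> act v (act w x) = act w (act v x)) ->
  betti R (fun e : Q * {set V} => e.2 \in L) (fun e => #|e.2|%:Z)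
    (kos_bd F act [set: V]) i%:Z =
  ((#|Q| * ncell i%:Z - kos_rank F L act [set: V] i%:Z
                      - kos_rank F L act [set: V] (i.+1)%:Z)%N%:R)%:E.
Proof.
move=> comm; rewrite betti_rank; first last.
- by move=> e eL; apply: (kos_bd_bd _ hL).
- move=> e eL y /(@kos_bd_on F V L hL _ act [set: V] e eL)[eL' <-].
  by split=> //; rewrite -addn1 PoszD.
by rewrite -rank_blockmx -blockmx_deg -PoszD addn1.
Qed.

Hypothesis hflag : flag L.
Variable Gam : nat -> groupClosed (raag L).
Hypothesis hGam : residual_chain Gam.

Lemma chain_subset k l : (k <= l)%N -> {subset Gam l <= Gam k}.
Proof.
have [sub _ _ _] := hGam; elim: l => [|l IHl]; first by rewrite leqn0 => /eqP->.
by rewrite leq_eqVlt => /orP[/eqP-> //|kl x /sub]; exact: IHl.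
Qed.

(** Each of the finitely many nontrivial powers below m leaves the chain at some stage and does not
    come back, as the chain is nested; K is the latest of these stages. *)
Lemma gen_power_notin m : exists K, forall k, (K <= k)%N -> forall v j, (0 < j < m)%N ->
  (gen L v ^+ j)%g \notin Gam k.
Proof.
have [_ _ _ res] := hGam.
have ex (p : V * 'I_m) : exists k, (0 < p.2)%N -> (gen L p.1 ^+ p.2)%g \notin Gam k.
  have [j0|] := ltnP 0 p.2; last by exists 0%N.
  apply: contrapT => nex; move/eqP: (@gen_order V L p.1 _ j0); apply; apply: res => k.
  by apply: contrapT => /negP nin; apply: nex; exists k.
have [kap kapP] := choice ex.
exists (\max_p kap p) => k le v j /andP[j0 jm].
apply: contra (kapP (v, Ordinal jm) j0); apply: chain_subset.
exact: leq_trans (leq_bigmax (v, Ordinal jm)) le.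
Qed.

Lemma quo_act_inj (N : groupClosed (raag L)) (nN : normal_subgroup N)
  (finN : finite_set (left_cosets N)) v : injective (@quo_act V L N finN v).
Proof.
move=> q q'; rewrite -[q](coset_repK finN) -[q'](coset_repK finN) !quo_actE // => e.
by have := coset_of_mulr nN (gen L v)^-1%g e; rewrite /rgen !mulgK.
Qed.

Lemma iter_quo_act (N : groupClosed (raag L)) (nN : normal_subgroup N)
    (finN : finite_set (left_cosets N)) v j q :
  (iter j (@quo_act V L N finN v) q == q) = ((gen L v ^+ j)%g \in N).
Proof.
have iterE x : iter j (@quo_act V L N finN v) (coset_of finN x) =
    coset_of finN (x * gen L v ^+ j)%g.
  by elim: j => [|j IHj]; rewrite ?expg0 ?mulg1 // iterS IHj quo_actE // expgSr mulgA.
rewrite -[q](coset_repK finN) iterE; apply/eqP/idP => [/esym/coset_ofP|h].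
  by rewrite mulKg.
by apply/esym/coset_ofP; rewrite mulKg.
Qed.

Lemma kos_rank0 (Q : finType) (act : V -> Q -> Q) i :
  kos_rank F L act finset.set0 i = (#|Q| * srank i)%N.
Proof. by rewrite /kos_rank blockmx_kos blockmx_deg -blockmxM rank_blockmx. Qed.

Theorem l2_betti_raag (i : nat) : l2_betti R F Gam i%:Z = reduced_betti R F L (i%:Z - 1).
Proof.
have [_ nor fin _] := hGam.
pose act k := @quo_act V L (Gam k) (fin k).
have comm k v w q : adjacent L v w -> act k v (act k w q) = act k w (act k v q).
  exact: quo_act_comm.
pose b k := (group_index (Gam k) * ncell i%:Z - kos_rank F L (act k) [set: V] i%:Z
                      - kos_rank F L (act k) [set: V] (i.+1)%:Z)%N.
have -> : l2_betti R F Gam i%:Z =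
    limn_esup (fun k => ((b k)%:R%:E * ((group_index (Gam k))%:R^-1)%:E)%E).
  rewrite /l2_betti; congr limn_esup; apply/funext => k; congr (_ * _)%E.
  rewrite (group_betti_kos R F hL hflag (nor k) (fin k)) kos_betti_rank; last exact: comm.
  by rewrite card_quo.
(* The factor 2 stands for the differentials into and out of degree i. Each costs one count of cells
   per vertex, and there are |Q| times [#|{set V}|] cells. *)
rewrite reduced_betti_rank; apply: (@limn_esup_ratio _ _ _ (2 * (#|V| * #|{set V}|))).
  by move=> k; rewrite -(card_quo (Gam k)); apply/card_gt0P; exists (coset_of (fin k) 1%g).
move=> m m0; have [K KP] := gen_power_notin m; exists K => k kK.
have free v q j : (0 < j < m)%N -> iter j (act k v) q != q.
  by move=> jm; rewrite iter_quo_act // KP.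
have bound := kos_rank_bound F hL (comm k) (@quo_act_inj _ (nor k) (fin k)) free [set: V].
have [b1 b2] := bound i%:Z; have [b3 b4] := bound (i.+1)%:Z.
move: b1 b2 b3 b4; rewrite !kos_rank0 card_prod cardsT card_quo /b.
set Q := group_index _; set W := #|{set V}|; set n := #|V|.
(* The products are generalized to leave a linear goal. Truncated subtraction cannot enlarge the
   error, so the two rank bounds add up. *)
rewrite !mulnBr; move: (kos_rank _ _ _ _ _) (kos_rank _ _ _ _ _) => r r'.
have -> : (n * (Q * W) = n * W * Q)%N by rewrite mulnCA mulnC.
rewrite -[(2 * _ * _)%N]mulnA; move: (n * W * Q)%N (m * (Q * _))%N (m * (Q * _))%N (m * (Q * _))%N.
move: (m * r)%N (m * r')%N => *.
lia.
Qed.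

End Growth.

Theorem theorem1 (R : realType) (F : fieldType) (V : finType)
    (L : {set {set V}}) (hL : simplicial_complex L) (hflag : flag L)
    (Gam : nat -> groupClosed (raag L)) (hGam : residual_chain Gam) (i : nat) :
  l2_betti R F Gam i%:Z = reduced_betti R F L (i%:Z - 1)%R.
Proof. exact: l2_betti_raag. Qed.
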